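(* Fix $\gamma>0$ and let $X$ be the diffusion on $\mathbf{R}^3$ defined in the context. Then $X$ is rotation invariant: for every orthogonal transformation $T:\mathbf{R}^3\to\mathbf{R}^3$, the process $T(X)=(T(X_t))_{t\ge0}$ has the same distribution as $X$; that is, the Dirichlet form of $T(X)$ on $L^2(\mathbf{R}^3,m)$ is $(\mathcal{E},\mathcal{F})$.
   Context: Setting. $\psi_\gamma(x)=\frac{\sqrt{\gamma}}{\sqrt{2\pi}}\frac{e^{-\gamma|x|}}{|x|}$, $m(dx)=\psi_\gamma(x)^2dx$ on $\mathbf{R}^3$, $\mathcal{F}=\{u\in L^2(\mathbf{R}^3,m):\nabla u\in L^2(\mathbf{R}^3,m)\}$ (distributional gradient), $\mathcal{E}(u,v)=\frac12\int_{\mathbf{R}^3}\nabla u\cdot\nabla v\,dm$, a regular Dirichlet form on $L^2(\mathbf{R}^3,m)$ with core $C_c^\infty(\mathbf{R}^3)$. $X$ is the associated $m$-symmetric diffusion on $\mathbf{R}^3$, with law $\mathbf{P}^x$ when started at $x$. The process $T(X)$ is regarded as a Markov process on $\mathbf{R}^3$ whose law when started at $x$ is the law of $(T(X_t))_{t\ge0}$ under $\mathbf{P}^{T^{-1}x}$. *)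

(* Defs.v *)
From HB Require Import structures.
From mathcomp Require Import all_boot all_order all_algebra.
From mathcomp Require Import all_classical all_reals all_analysis.
From mathcomp Require Import measurable_realfun.

Set Implicit Arguments.
Unset Strict Implicit.
Unset Printing Implicit Defensive.

Import Order.TTheory GRing.Theory Num.Theory.
Import numFieldNormedType.Exports.

Local Open Scope classical_set_scope.
Local Open Scope ring_scope.

(* Points of R^n are row vectors; their sigma-algebra is the Borel one. *)
Section borel_rV.
Context (R : realType) (n : nat).

Let rV_open : set (set 'rV[R]_n) := [set A | open A].

Let rV_borelC (A : set 'rV[R]_n) : <<s rV_open >> A -> <<s rV_open >> (~` A).
Proof. by move=> bA; rewrite -setTD; exact: sigma_algebraCD. Qed.

HB.instance Definition _ := @isMeasurable.Build (sigma_display rV_open)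
  'rV[R]_n <<s rV_open >> (@sigma_algebra0 _ setT rV_open) rV_borelC
  (@sigma_algebra_bigcup _ setT rV_open).

Lemma open_measurable_rV (A : set 'rV[R]_n) : open A -> measurable A.
Proof. by move=> oA; exact: sub_sigma_algebra. Qed.

Lemma continuous_measurable_rV (f : 'rV[R]_n -> R) :
  continuous f -> measurable_fun setT f.
Proof.
move=> /continuousP cf; apply: (measurability _ (RGenOpens.measurableE R)).
move=> _ [_ [a [b ->] <-]]; rewrite setTI.
by apply: open_measurable_rV; apply: cf; exact: interval_open.
Qed.

Lemma measurable_coord (i : 'I_n) :
  measurable_fun setT (fun x : 'rV[R]_n => x 0 i).
Proof. by apply: continuous_measurable_rV; exact: coord_continuous. Qed.

Lemma measurable_fun_rV d (T : measurableType d) (f : T -> 'rV[R]_n) :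
  (forall i, measurable_fun setT (fun t => f t 0 i)) -> measurable_fun setT f.
Proof.
move=> mf; apply: (@measurability _ _ T 'rV[R]_n setT f rV_open) => //.
move=> _ [A oA <-]; rewrite setTI.
pose B (qk : 'rV[rat]_n * nat) : set 'rV[R]_n :=
  ball (map_mx ratr qk.1 : 'rV[R]_n) qk.2.+1%:R^-1.
have -> : f @^-1` A = \bigcup_qk
    (if `[< B qk `<=` A >] then f @^-1` B qk else set0).
  apply/seteqP; split=> [t /= At|t [qk _] /=]; last first.
    by case: ifPn => // /asboolP BA; exact: BA.
  have /nbhs_ballP[e /= e0 eA] := open_nbhs_nbhs (conj oA At).
  pose k := Num.trunc (2 / e).
  have rk0 : 0 < k.+1%:R^-1 :> R by rewrite invr_gt0.
  have ke : k.+1%:R^-1 + k.+1%:R^-1 <= e.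
    rewrite -mulr2n -(mulr_natl _ 2) ler_pdivrMr// mulrC -ler_pdivrMr//.
    exact/ltW/truncnS_gt.
  have /choice[q qP] : forall i, exists q : rat,
      ball (f t 0 i) k.+1%:R^-1 (ratr q : R).
    move=> i; have [r [xB [q _ qr]]] := @dense_rat R (ball (f t 0 i) k.+1%:R^-1)
      (ex_intro _ _ (ballxx _ rk0)) (ball_open _ _).
    by exists q; rewrite qr.
  have qB : ball (map_mx ratr (\row_i q i) : 'rV[R]_n) k.+1%:R^-1 (f t).
    by split=> // i j; rewrite !mxE ord1; apply: ball_sym; exact: qP.
  exists (\row_i q i, k) => //=; rewrite asboolT//= => y qy; apply: eA.
  by apply: le_ball ke _ _; apply: ball_triangle qy; exact: ball_sym.
apply: countable_bigcupT_measurable => [|qk]; first exact: countableP.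
case: ifP => // _.
have -> : f @^-1` B qk = \bigcap_(i in [set: 'I_n])
    (fun t => f t 0 i) @^-1` ball (ratr (qk.1 0 i) : R) qk.2.+1%:R^-1.
  apply/seteqP; split=> [t [_ /= h] i _ /=|t h].
    by have := h 0 i; rewrite mxE.
  by split=> [|i j]; rewrite ?invr_gt0// ord1 mxE; exact: h.
apply: fin_bigcap_measurable => // i _.
by rewrite -[X in measurable X]setTI; apply: mf => //; exact: measurable_ball.
Qed.

End borel_rV.

Section lebesgue3.
Context (R : realType).
Local Notation mu := (@lebesgue_measure R).

Definition row3 (p : R * R * R) : 'rV[R]_3 :=
  \row_(i < 3) nth 0 [:: p.1.1; p.1.2; p.2] i.

Lemma measurable_row3 : measurable_fun setT row3.
Proof.
apply: measurable_fun_rV => -[[|[|[|//]]] i3].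
- apply: (eq_measurable_fun (fun p : R * R * R => p.1.1)) => [p _|].
    by rewrite mxE.
  exact: (measurableT_comp measurable_fst).
- apply: (eq_measurable_fun (fun p : R * R * R => p.1.2)) => [p _|].
    by rewrite mxE.
  exact: (measurableT_comp measurable_snd).
- apply: (eq_measurable_fun (fun p : R * R * R => p.2)) => [p _|].
    by rewrite mxE.
  exact: measurable_snd.
Qed.

(* Lebesgue measure dx on R^3. *)
Definition lebesgue3 : set 'rV[R]_3 -> \bar R :=
  pushforward (mu \x mu \x mu)%E row3.

Let lebesgue3_0 : lebesgue3 set0 = 0%E.
Proof. by rewrite /lebesgue3 /pushforward preimage_set0 measure0. Qed.

Let lebesgue3_ge0 A : (0 <= lebesgue3 A)%E.
Proof. exact: (measure_ge0 (mu \x mu \x mu)%E). Qed.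

Let lebesgue3_sigma_additive : semi_sigma_additive lebesgue3.
Proof.
have mpre A : measurable A -> measurable (row3 @^-1` A).
  by move=> mA; rewrite -[X in measurable X]setTI; exact: measurable_row3.
move=> F mF tF mUF; rewrite /lebesgue3 /pushforward preimage_bigcup.
apply: measure_semi_sigma_additive.
- by move=> n; exact: mpre.
- apply/trivIsetP => /= i j _ _ ij; rewrite -preimage_setI.
  by move/trivIsetP : tF => /(_ _ _ _ _ ij) ->//; rewrite preimage_set0.
- by rewrite -preimage_bigcup; exact: mpre.
Qed.

HB.instance Definition _ := isMeasure.Build _ _ _ lebesgue3
  lebesgue3_0 lebesgue3_ge0 lebesgue3_sigma_additive.

End lebesgue3.
Arguments lebesgue3 {R}.

Section reference_measure.
Context (R : realType).
Implicit Types (x y : 'rV[R]_3) (gamma : R).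

Definition dot x y : R := \sum_(i < 3) x 0 i * y 0 i.

(* The norm `|x| of the library is the sup norm on row vectors. *)
Definition enorm x : R := Num.sqrt (dot x x).

Definition psi gamma x : R :=
  Num.sqrt gamma / Num.sqrt (2 * pi) * (expR (- gamma * enorm x) / enorm x).

Lemma measurable_enorm : measurable_fun setT enorm.
Proof.
apply: (eq_measurable_fun (fun x => dot x x `^ 2^-1)) => [x _|].
  rewrite powR12_sqrt// sumr_ge0// => i _.
  by rewrite -expr2 sqr_ge0.
apply: (measurableT_comp (measurable_powR _)).
apply: measurable_sum => i.
by apply: measurable_funM; exact: measurable_coord.
Qed.

Lemma measurable_psi gamma : measurable_fun setT (psi gamma).
Proof.
apply: measurable_funM => //; apply: measurable_funM.
  apply: (measurableT_comp (@measurable_expR R)).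
  by apply: measurable_funM => //; exact: measurable_enorm.
apply: (eq_measurable_fun (fun x => enorm x `^ (-1))) => [x _|].
  by rewrite powR_inv1// sqrtr_ge0.
exact: (measurableT_comp (measurable_powR _) measurable_enorm).
Qed.

(* m(dx) = psi(x)^2 dx *)
Definition refm gamma (A : set 'rV[R]_3) : \bar R :=
  (\int[lebesgue3]_(x in A) (psi gamma x ^+ 2)%:E)%E.

Section measure.
Variable gamma : R.

Let refm0 : refm gamma set0 = 0%E.
Proof. by rewrite /refm integral_set0. Qed.

Let refm_ge0 A : (0 <= refm gamma A)%E.
Proof. by apply: integral_ge0 => x _; rewrite lee_fin sqr_ge0. Qed.

Let refm_sigma_additive : semi_sigma_additive (refm gamma).
Proof.
move=> /= F mF tF mUF; rewrite /refm; apply: cvg_toP.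
  apply: ereal_nondecreasing_is_cvgn => m n mn.
  apply: lee_sum_nneg_natr => // k _ _.
  by apply: integral_ge0 => x _; rewrite lee_fin sqr_ge0.
rewrite ge0_integral_bigcup//=.
- apply: measurable_funTS; apply: measurableT_comp => //.
  by apply: measurable_funX; exact: measurable_psi.
- by move=> x _; rewrite lee_fin sqr_ge0.
Qed.

HB.instance Definition _ := isMeasure.Build _ _ _ (refm gamma)
  refm0 refm_ge0 refm_sigma_additive.

End measure.
End reference_measure.

Section energy_form.
Context (R : realType).
Implicit Types (u v phi : 'rV[R]_3 -> R) (gamma : R).

Fixpoint Ck (k : nat) phi : Prop :=
  if k is k'.+1 then
    (forall x, differentiable phi x) /\ (forall e, Ck k' ('D_e phi))
  else continuous phi.

(* C_c^oo(R^3) *)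
Definition test_function phi : Prop :=
  (forall k, Ck k phi) /\
  (exists2 K, compact K & forall x, ~ K x -> phi x = 0).

(* g is the distributional gradient of u. Elements of L^2(m) are locally
   integrable for dx, because psi is bounded below on bounded sets, so both
   integrals below converge for u and g in L^2(m). *)
Definition weak_gradient u (g : 'rV[R]_3 -> 'rV[R]_3) : Prop :=
  forall (i : 'I_3) phi, test_function phi ->
    \int[lebesgue3]_x (u x * 'D_(delta_mx 0 i) phi x) =
    - \int[lebesgue3]_x (g x 0 i * phi x).

Definition L2 gamma : set ('rV[R]_3 -> R) :=
  [set u | u \in Lfun (refm gamma) 2%:E].

Definition L2_gradient gamma u : set ('rV[R]_3 -> 'rV[R]_3) :=
  [set g | weak_gradient u g /\ forall i, L2 gamma (fun x => g x 0 i)].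

(* Functions are representatives: membership in F and the value of E depend
   only on classes modulo m-null sets. *)
Definition form_domain gamma : set ('rV[R]_3 -> R) :=
  [set u | L2 gamma u /\ L2_gradient gamma u !=set0].

(* The gradient is unique up to null sets, and xget selects a version of it. *)
Definition grad gamma u : 'rV[R]_3 -> 'rV[R]_3 :=
  xget (fun=> 0) (L2_gradient gamma u).

Definition form gamma u v : R :=
  2^-1 * \int[refm gamma]_x (dot (grad gamma u x) (grad gamma v x)).

End energy_form.

(* A process on R^3 is a family X of random points, indexed by the times t >= 0,
   and a family P of laws, P x being the law of the process started at x.
   The values of X at negative times are irrelevant. *)
Section processes.
Context (R : realType) d (Omega : measurableType d).
Variables (X : R -> Omega -> 'rV[R]_3) (P : 'rV[R]_3 -> probability Omega R).

Definition natural_filtration (t : R) : set (set Omega) :=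
  <<s [set A | exists s B,
         [/\ 0 <= s <= t, measurable B & A = X s @^-1` B]] >>.

Definition right_filtration (t : R) : set (set Omega) :=
  [set A | forall s, t < s -> natural_filtration s A].

Definition stopping_time (tau : Omega -> \bar R) : Prop :=
  (forall w, 0 <= tau w)%E /\
  (forall t, 0 <= t -> right_filtration t [set w | (tau w <= t%:E)%E]).

(* The events prior to tau. *)
Definition stopped_filtration (tau : Omega -> \bar R) : set (set Omega) :=
  [set A | measurable A /\ forall t, 0 <= t ->
    right_filtration t (A `&` [set w | (tau w <= t%:E)%E])].

Definition strong_markov : Prop :=
  forall tau, stopping_time tau ->
  forall A, stopped_filtration tau A ->
  forall x s B, 0 <= s -> measurable B ->
    (P x (A `&` [set w | tau w < +oo] `&`
            [set w | B (X (fine (tau w) + s)%R w)]) =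
     \int[P x]_(w in A `&` [set w | tau w < +oo])
        P (X (fine (tau w)) w) (X s @^-1` B))%E.

(* Continuous strong Markov process on R^3 with infinite lifetime. *)
Record diffusion : Prop := Diffusion {
  diffusion_measurable : forall t, 0 <= t -> measurable_fun setT (X t);
  diffusion_kernel : forall t B, 0 <= t -> measurable B ->
    measurable_fun setT (fun x => P x (X t @^-1` B));
  diffusion_start : forall x, P x [set w | X 0 w = x] = 1%E;
  diffusion_continuous :
    forall w, {within `[0, +oo[, continuous (fun t => X t w)};
  diffusion_strong_markov : strong_markov }.

(* Symmetry of the transition semigroup with respect to m. *)
Definition symmetric_process (m : {measure set 'rV[R]_3 -> \bar R}) : Prop :=
  forall t (f g : 'rV[R]_3 -> \bar R), 0 <= t ->
    measurable_fun setT f -> measurable_fun setT g ->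
    (forall x, 0 <= f x)%E -> (forall x, 0 <= g x)%E ->
    (\int[m]_x ((\int[P x]_w f (X t w)) * g x) =
     \int[m]_x (f x * (\int[P x]_w g (X t w))))%E.

Definition semigroup (t : R) (u : 'rV[R]_3 -> R) (x : 'rV[R]_3) : R :=
  \int[P x]_w u (X t w).

Definition approx_form (m : {measure set 'rV[R]_3 -> \bar R}) (t : R)
    (u v : 'rV[R]_3 -> R) : R :=
  t^-1 * \int[m]_x ((u x - semigroup t u x) * v x).

(* (F, E) is the Dirichlet form on L^2(m) of the m-symmetric process:
   F = { u in L^2(m) | lim_{t -> 0} (u - P_t u, u) / t exists and is finite },
   E(u, v) = lim_{t -> 0} (u - P_t u, v) / t for u, v in F. *)
Definition dirichlet_form_of (m : {measure set 'rV[R]_3 -> \bar R})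
    (E : ('rV[R]_3 -> R) -> ('rV[R]_3 -> R) -> R)
    (F : set ('rV[R]_3 -> R)) : Prop :=
  F = [set u | u \in Lfun m 2%:E /\
               cvg (approx_form m t u u @[t --> 0^'+])] /\
  (forall u v, F u -> F v -> approx_form m t u v @[t --> 0^'+] --> E u v).

(* The m-symmetric diffusion associated with the form (E, F) of parameter
   gamma. *)
Definition associated_diffusion (gamma : R) : Prop :=
  [/\ diffusion, symmetric_process (refm gamma) &
      dirichlet_form_of (refm gamma) (form gamma) (form_domain gamma)].

End processes.

(* The law of T(X) started at x is that of (T (X_t))_t under P^(T^-1 x), for T
   the linear map x |-> x *m Q with Q invertible. *)
Section image_process.
Context (R : realType) d (Omega : measurableType d).
Variable Q : 'M[R]_3.

Definition image_process (X : R -> Omega -> 'rV[R]_3) : R -> Omega -> 'rV[R]_3 :=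
  fun t w => X t w *m Q.

Definition image_law (P : 'rV[R]_3 -> probability Omega R) :
    'rV[R]_3 -> probability Omega R :=
  fun x => P (x *m invmx Q).

End image_process.

(* Main.v *)
Require Import Defs.
From HB Require Import structures.
From mathcomp Require Import all_boot all_order all_algebra.
From mathcomp Require Import all_classical all_reals all_analysis.
From mathcomp Require Import measurable_realfun ring lra.

(** Write [T] for [x |-> x *m Q]. Every clause about the process [T(X)] under
    the laws [P^(T^-1 x)] is the corresponding clause about [X], read through
    [T]: the filtrations coincide because [T] is a bimeasurable bijection, and
    the symmetry and the approximating forms of [T(X)] at [(u, v)] are those
    of [X] at [(u o T, v o T)] because [T] preserves [m]. So the whole content
    is that [m], [F] and [E] do not change under [u |-> u o T].

    The measure. The density of [m] is a function of the Euclidean norm, so it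
    is enough that [dx] be rotation invariant ([preserves_orthogonal]).
    Translation invariance and Tonelli reduce this to the fact that the
    Euclidean unit ball is fixed by rotations and has a finite positive volume.
    Integrals over [m] are then invariant for arbitrary integrands
    ([integral_comp_iso]), as [T] permutes the simple functions.

    The form. If [g] is a weak gradient of [u], then [x |-> g(xQ) Q^T] is one of
    [u o T] ([L2_gradient_rotation]), by the change of variables [T] in the
    integration by parts formula. The form, however, is computed with gradients
    selected arbitrarily among all versions, so that the equality
    [E(u o T, v o T) = E(u, v)] needs the uniqueness of weak gradients up to
    null sets ([L2_gradient_unique]). This is the lemma of du Bois-Reymond:
    elements of [L^2(m)] are integrable for [dx] on bounded sets because the
    density is bounded below there ([L2_integrable_on_cubes]), and the
    indicators of the sets [{phi > 0}], [phi] a nonnegative test function, are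
    bounded limits of test functions. These sets form a pi-system that generates
    the Borel sets. The test functions are built from [t |-> exp(-1/t)]. *)

Set Implicit Arguments.
Unset Strict Implicit.
Unset Printing Implicit Defensive.

Import Order.TTheory GRing.Theory Num.Theory.
Import numFieldNormedType.Exports.

Local Open Scope classical_set_scope.
Local Open Scope ring_scope.

(** * Changes of variables *)

Lemma measurable_preimage d1 d2 (T1 : measurableType d1) (T2 : measurableType d2)
    (f : T1 -> T2) (A : set T2) :
  measurable_fun setT f -> measurable A -> measurable (f @^-1` A).
Proof. by move=> mf mA; rewrite -[X in measurable X]setTI; exact: mf. Qed.

Section integral_isomorphism.
Context d (T : measurableType d) (R : realType).
Variable mu : {measure set T -> \bar R}.
Import HBNNSimple.

(** A simple function [h] below [f \o phi] gives the simple function [h \o psi] below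
    [f], with the same integral. *)
Let le_integral_comp (phi psi : T -> T) (f : T -> \bar R) :
    measurable_fun setT psi -> cancel psi phi ->
    (forall A, measurable A -> mu (psi @^-1` A) = mu A) ->
    (forall x, 0 <= f x)%E ->
  (\int[mu]_x f (phi x) <= \int[mu]_x f x)%E.
Proof.
move=> mpsi psiK mu_psi f0.
rewrite !ge0_integralTE//; apply: ge_ereal_sup => _ /= [h hf <-].
have mh : measurable_fun setT (h \o psi) by exact: measurableT_comp.
have fh : finite_set (range (h \o psi)).
  apply: sub_finite_set (fimfunP h) => _ [x _ <-] /=.
  by exists (psi x).
have h0 x : 0 <= (h \o psi) x by exact: fun_ge0.
pose m1 := isMeasurableFun.Build _ _ _ _ _ mh.
pose m2 := FiniteImage.Build _ _ _ fh.
pose m3 := isNonNegFun.Build _ _ _ h0.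
pose k : {nnsfun T >-> R} := HB.pack (h \o psi) m1 m2 m3.
apply: ereal_sup_ubound; exists k => /=.
  by move=> x; rewrite /= -{2}(psiK x); exact: hf.
apply: eq_fsbigr => r _; congr (_ * _)%E.
exact: (mu_psi (h @^-1` [set r])).
Qed.

(** Composition with [phi] is a bijection between the simple functions below [f]
    and those below [f \o phi], and it preserves their integrals. The equality thus
    holds for an arbitrary [f], in particular for integrands that involve the
    semigroup of a process. *)
Lemma integral_comp_iso (phi psi : T -> T) (f : T -> \bar R) :
    measurable_fun setT phi -> measurable_fun setT psi ->
    cancel phi psi -> cancel psi phi ->
    (forall A, measurable A -> mu (phi @^-1` A) = mu A) ->
  (\int[mu]_x f (phi x) = \int[mu]_x f x)%E.
Proof.
move=> mphi mpsi phiK psiK mu_phi.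
have mu_psi A : measurable A -> mu (psi @^-1` A) = mu A.
  move=> mA; rewrite -[LHS]mu_phi.
    by congr (mu _); apply/seteqP; split=> x /=; rewrite phiK.
  exact: measurable_preimage.
have ge0_eq (g : T -> \bar R) : (forall x, 0 <= g x)%E ->
    (\int[mu]_x g (phi x) = \int[mu]_x g x)%E.
  move=> g0; apply/eqP; rewrite eq_le; apply/andP; split.
    exact: (le_integral_comp mpsi).
  have -> : (\int[mu]_x g x = \int[mu]_x (g \o phi) (psi x))%E.
    by apply: eq_integral => x _; rewrite /= psiK.
  by apply: (le_integral_comp mphi phiK mu_phi) => x; exact: g0.
rewrite integralE [RHS]integralE -(ge0_eq f^\+%E)// -(ge0_eq f^\-%E)//.
by congr (_ - _)%E; apply: eq_integral => x _; rewrite ?funeposE ?funenegE.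
Qed.

End integral_isomorphism.

(** * Linear maps of R^n *)

Section linear_maps.
Context (R : realType) (n : nat).
Implicit Type Q : 'M[R]_n.

Lemma continuous_mulmxr Q : continuous (fun x : 'rV[R]_n => x *m Q).
Proof.
have -> : (fun x : 'rV[R]_n => x *m Q) =
    \sum_i (fun x => x 0 i *: row i Q).
  by apply/funext => x; rewrite fct_sumE; exact: mulmx_sum_row.
move=> x; elim/big_ind : _ => [|f g cf cg|i _].
- exact: cst_continuous.
- exact: continuousD.
- apply: (@continuous_comp _ _ _ (fun y : 'rV[R]_n => y 0 i)
    (fun t => t *: row i Q)); first exact: coord_continuous.
  exact: scalel_continuous.
Qed.

Lemma measurable_continuous_rV m (f : 'rV[R]_n -> 'rV[R]_m) :
  continuous f -> measurable_fun setT f.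
Proof.
move=> cf; apply: measurable_fun_rV => i.
apply: continuous_measurable_rV => x.
by apply: (@continuous_comp _ _ _ f (fun y => y 0 i)); [exact: cf|exact: coord_continuous].
Qed.

Lemma measurable_mulmxr Q : measurable_fun setT (fun x : 'rV[R]_n => x *m Q).
Proof. by apply: measurable_continuous_rV; exact: continuous_mulmxr. Qed.

Lemma differentiable_mulmxr Q (x : 'rV[R]_n) :
  differentiable (fun x : 'rV[R]_n => x *m Q) x.
Proof.
exact: (@linear_differentiable R _ _
  (mulmxr Q : {linear 'rV[R]_n -> 'rV[R]_n}) x (@continuous_mulmxr Q)).
Qed.

Lemma measurable_addrV :
  measurable_fun setT (fun p : 'rV[R]_n * 'rV[R]_n => p.1 + p.2).
Proof.
apply: measurable_fun_rV => i.
apply: (eq_measurable_fun (fun p : 'rV[R]_n * 'rV[R]_n => p.1 0 i + p.2 0 i)).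
  by move=> p _; rewrite mxE.
by apply: measurable_funD; apply: (measurableT_comp (measurable_coord i)).
Qed.

End linear_maps.

Lemma ord3_ind (P : 'I_3 -> Prop) : P 0 -> P 1 -> P 2%:R -> forall i, P i.
Proof.
by move=> P0 P1 P2 [[|[|[|//]]] i3]; [move: P0|move: P1|move: P2];
  congr P; exact: val_inj.
Qed.

(** * Translations and rotations preserve the Lebesgue measure *)

Definition preserves d (T : measurableType d) (R : realType)
    (m : set T -> \bar R) (f : T -> T) : Prop :=
  measurable_fun setT f /\ forall A, measurable A -> m (f @^-1` A) = m A.

(** [m] is only asked to agree with the product measure on rectangles, so that the
    lemma applies whatever the packaging of the product as a measure is. *)
Lemma preserves_product d1 d2 (T1 : measurableType d1) (T2 : measurableType d2)
    (R : realType) (m1 : {sigma_finite_measure set T1 -> \bar R})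
    (m2 : {sigma_finite_measure set T2 -> \bar R})
    (m : {measure set (T1 * T2) -> \bar R}) (f1 : T1 -> T1) (f2 : T2 -> T2) :
  (forall A B, measurable A -> measurable B -> m (A `*` B) = m1 A * m2 B)%E ->
  preserves m1 f1 -> preserves m2 f2 ->
  preserves m (fun p => (f1 p.1, f2 p.2)).
Proof.
move=> mE [mf1 m1f1] [mf2 m2f2].
have mf : measurable_fun setT (fun p : T1 * T2 => (f1 p.1, f2 p.2)).
  by apply: measurable_fun_pair; apply: measurableT_comp.
split=> // A mA.
pose f : {mfun _ >-> _} := HB.pack (fun p : T1 * T2 => (f1 p.1, f2 p.2))
  (isMeasurableFun.Build _ _ _ _ _ mf).
rewrite -[RHS](product_measure_unique mE)//; apply/esym.
apply: (@product_measure_unique _ _ _ _ _ m1 m2 (pushforward m f)) => //.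
move=> B C mB mC.
transitivity (m ((f1 @^-1` B) `*` (f2 @^-1` C))); first by [].
rewrite mE; [|exact: measurable_preimage..].
by congr (_ * _)%E; [exact: m1f1|exact: m2f2].
Qed.

Lemma preserves_shift (R : realType) (a : R) :
  preserves (@lebesgue_measure R) (fun t => t + a).
Proof.
have mf : measurable_fun setT (fun t : measurableTypeR R => t + a : measurableTypeR R).
  exact: measurable_funD.
split=> // A mA.
pose f : {mfun measurableTypeR R >-> measurableTypeR R} :=
  HB.pack (fun t : measurableTypeR R => t + a : measurableTypeR R)
  (isMeasurableFun.Build _ _ _ _ _ mf).
apply/esym.
apply: (@lebesgue_measure_unique R (pushforward (@lebesgue_measure R) f)) => //.
move=> _ [[b c] _ <-].
transitivity (@lebesgue_measure R `]b - a, c - a]%classic); last first.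
  rewrite /pushforward; congr lebesgue_measure.
  by apply/seteqP; split=> t /=; rewrite !in_itv/= ltrBlDr lerBrDr.
rewrite /= !lebesgue_measure_itv/= !lte_fin ltrD2r; case: ifP => // _.
by rewrite -!EFinB; congr EFin; rewrite opprB addrA subrK.
Qed.

(** Tonelli: the set [{(z, y) | A z /\ B (y + g z)}] has measure [m A * m B], because
    its section at [z] is a translate of [B] if [A z], and is empty otherwise. The
    left-hand side integrates the sections at [y]. *)
Lemma integral_sheared_section (R : realType) n
    (m : {sigma_finite_measure set 'rV[R]_n -> \bar R})
    (A B : set 'rV[R]_n) (g : 'rV[R]_n -> 'rV[R]_n) :
    (forall x, preserves m (fun y => y + x)) ->
    measurable A -> measurable B -> measurable_fun setT g ->
  (\int[m]_y m [set z | A z /\ B (y + g z)%R] = m A * m B)%E.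
Proof.
move=> m_shift mA mB mg.
pose S := [set p : 'rV[R]_n * 'rV[R]_n | A p.1 /\ B (p.2 + g p.1)].
have mS : measurable S.
  apply: (@measurableI _ _ (fst @^-1` A) ((fun p => p.2 + g p.1) @^-1` B)).
    exact: measurable_preimage.
  apply: measurable_preimage => //.
  apply: (@measurableT_comp _ _ _ _ _ _ _ _
    (fun p : 'rV[R]_n * 'rV[R]_n => (p.2, g p.1)) (@measurable_addrV R n)).
  by apply: measurable_fun_pair => //; apply: measurableT_comp.
have FG : (\int[m]_z m (xsection S z) = \int[m]_y m (ysection S y))%E.
  have := @indic_fubini_tonelli _ _ _ _ _ m m S mS.
  by rewrite indic_fubini_tonelli_FE// indic_fubini_tonelli_GE.
transitivity (\int[m]_y m (ysection S y))%E.
  apply: eq_integral => y _; congr (m _).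
  by apply/seteqP; split=> z; rewrite /ysection/= inE.
rewrite -[LHS]FG.
rewrite (eq_integral (fun z => (\1_A z)%:E * m B)%E) => [|z _].
  rewrite ge0_integralZr ?integral_indic ?setIT//; exact: measurableT_comp.
have [_ preB] := m_shift (g z).
rewrite indicE; have [zA|zA] := boolP (z \in A); rewrite (mul1e, mul0e).
  rewrite -[RHS]preB//; congr (m _).
  apply/seteqP; split=> y; rewrite /xsection/= inE /S /=; first by case.
  by move=> yB; split=> //; exact: set_mem.
rewrite (_ : xsection S z = set0) ?measure0//.
apply/seteqP; split=> y //; rewrite /xsection/= inE => -[/mem_set].
by rewrite (negbTE zA).
Qed.

Lemma mule_cancel (R : realFieldType) (b : R) (x y : \bar R) :
  0 < b -> (b%:E * x = y * b%:E)%E -> y = x.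
Proof.
move=> b0 xy; have bV : (b%:E * b^-1%:E = 1)%E.
  by rewrite -EFinM mulfV// gt_eqF.
by rewrite -[LHS]mule1 -[in LHS]bV muleA -xy muleAC bV mul1e.
Qed.

Section lebesgue3_invariance.
Context (R : realType).
Local Notation mu := (@lebesgue_measure R).
Implicit Types (x y : 'rV[R]_3) (A B : set 'rV[R]_3).

Definition box (A : 'I_3 -> set R) : set 'rV[R]_3 := [set x | forall i, A i (x 0 i)].

Lemma preimage_box (A : 'I_3 -> set R) :
  @row3 R @^-1` box A = A 0 `*` A 1 `*` A 2%:R.
Proof.
apply/seteqP; split=> [[[a b] c] /= h|[[a b] c] /= [[h0 h1] h2]].
  by have := (h 0, h 1, h 2%:R); rewrite !mxE /= => -[[]].
by apply: ord3_ind; rewrite mxE.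
Qed.

Lemma measurable_box (A : 'I_3 -> set R) :
  (forall i, measurable (A i)) -> measurable (box A).
Proof.
move=> mA; rewrite (_ : box A = \bigcap_(i in [set: 'I_3]) (fun x => x 0 i) @^-1` A i).
  apply: fin_bigcap_measurable => // i _.
  by rewrite -[X in measurable X]setTI; exact: measurable_coord.
by apply/seteqP; split=> [x h i _|x h i]; exact: h.
Qed.

Lemma lebesgue3_box (A : 'I_3 -> set R) : (forall i, measurable (A i)) ->
  lebesgue3 (box A) = (mu (A 0%R) * mu (A 1%R) * mu (A 2%:R%R))%E.
Proof.
move=> mA; rewrite /lebesgue3 /pushforward preimage_box.
rewrite product_measure1E; last exact: (mA 2%:R).
  by congr (_ * _)%E; apply: product_measure1E; exact: mA.
exact: (@measurableX _ _ (measurableTypeR R) (measurableTypeR R) _ _ (mA 0) (mA 1)).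
Qed.

(** A copy of the product measure on the plane, on which the structure of
    sigma-finite measure can be declared. *)
Definition lebesgue2 : set (measurableTypeR R * measurableTypeR R) -> \bar R :=
  (mu \x mu)%E.

HB.instance Definition _ := Measure.copy lebesgue2 (mu \x mu)%E.

Lemma sigma_finite_lebesgue2 : sigma_finite setT lebesgue2.
Proof.
have /sigma_finiteP[F [TF ndF Foo]] := sigma_finiteT mu.
exists (fun n => F n `*` F n) => [|k].
  rewrite -setXTT TF predeqE => -[x y]; split=> [[[n _ Fnx] [k _ Fky]]|[n _ []/= ? ?]].
    exists (maxn n k) => //; split.
    - by have /subsetPset := ndF _ _ (leq_maxl n k); exact.
    - by have /subsetPset := ndF _ _ (leq_maxr n k); exact.
  by split; exists n.
have [mF Fk] := Foo k; split; first exact: measurableX.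
rewrite [ltLHS](_ : _ = (mu (F k) * mu (F k))%E).
  by rewrite lte_mul_pinfty// ge0_fin_numE.
exact: product_measure1E.
Qed.

HB.instance Definition _ :=
  @Measure_isSigmaFinite.Build _ _ _ lebesgue2 sigma_finite_lebesgue2.

Lemma preserves_shift3 x : preserves lebesgue3 (fun y => y + x).
Proof.
pose T := measurableTypeR R.
pose f (p : T * T * T) : T * T * T := (p.1.1 + x 0 0, p.1.2 + x 0 1, p.2 + x 0 2%:R).
have [mf lf] : preserves (mu \x mu \x mu)%E f.
  apply: (@preserves_product _ _ (T * T)%type T R lebesgue2 mu _
    (fun p : T * T => (p.1 + x 0 0, p.2 + x 0 1)) (fun p => p + x 0 2%:R)).
  - by move=> A B mA mB; rewrite [LHS]product_measure1E.
  - apply: (@preserves_product _ _ T T R mu mu _ (fun p => p + x 0 0)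
      (fun p => p + x 0 1)); [|exact: preserves_shift..].
    by move=> A B mA mB; rewrite [LHS]product_measure1E.
  - exact: preserves_shift.
split=> [|A mA].
  by apply: measurable_continuous_rV => y; apply: continuousD;
    [exact: cvg_id|exact: cst_continuous].
rewrite /lebesgue3 /pushforward -[RHS]lf; last first.
  by apply: measurable_preimage => //; exact: measurable_row3.
have E p : row3 p + x = row3 (f p).
  by apply/rowP; apply: ord3_ind; rewrite !mxE.
by congr ((_ \x _)%E _); apply/seteqP; split=> p /=; rewrite E.
Qed.

Definition cube (r : R) := box (fun=> `]- r, r[%classic).

Lemma measurable_cube r : measurable (cube r).
Proof. by apply: measurable_box => i; exact: measurable_itv. Qed.

Lemma cubeP r x : cube r x <-> forall i, `|x 0 i| < r.
Proof.
by split=> h i; have := h i; rewrite /= in_itv/= ltr_norml.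
Qed.

Lemma lebesgue3_cube r : 0 <= r -> lebesgue3 (cube r) = ((r *+ 2) ^+ 3)%:E.
Proof.
move=> r0; rewrite lebesgue3_box => [|i]; last exact: measurable_itv.
have -> : lebesgue_measure `]- r, r[%classic = (r *+ 2)%:E.
  rewrite lebesgue_measure_itv/= lte_fin -EFinD opprK -mulr2n.
  have [->|rn0] := eqVneq r 0; first by rewrite oppr0 ltxx mul0rn.
  by rewrite gtrN// lt_neqAle eq_sym rn0.
by rewrite -!EFinM !exprS expr0 mulr1 mulrA.
Qed.

Lemma sigma_finite_lebesgue3 : sigma_finite setT (@lebesgue3 R).
Proof.
exists (fun n => cube n%:R); last first.
  by move=> n; split; [exact: measurable_cube|rewrite lebesgue3_cube// ltry].
apply/seteqP; split=> // x _.
exists (Num.trunc (\sum_i `|x 0 i|)).+1 => //.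
apply/cubeP => i; apply: le_lt_trans (truncnS_gt _).
by rewrite (bigD1 i)//= lerDl sumr_ge0.
Qed.

HB.instance Definition _ := @Measure_isSigmaFinite.Build _ _ _ (@lebesgue3 R)
  sigma_finite_lebesgue3.

Lemma dotE x y : dot x y = (x *m y^T) 0 0.
Proof. by rewrite mxE; apply: eq_bigr => i _; rewrite mxE. Qed.

Lemma dot_mulmxr (Q : 'M[R]_3) x y : Q *m Q^T = 1%:M ->
  dot (x *m Q) (y *m Q) = dot x y.
Proof.
by move=> QQT; rewrite !dotE trmx_mul mulmxA -(mulmxA x) QQT mulmx1.
Qed.

Lemma measurable_dot (f g : 'rV[R]_3 -> 'rV[R]_3) :
  measurable_fun setT f -> measurable_fun setT g ->
  measurable_fun setT (fun x => dot (f x) (g x)).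
Proof.
move=> mf mg; apply: measurable_sum => i.
by apply: measurable_funM; apply: (measurableT_comp (measurable_coord i)).
Qed.

Let ball1 : set 'rV[R]_3 := [set x | dot x x < 1].

Let measurable_ball1 : measurable ball1.
Proof.
rewrite (_ : ball1 = (fun x => dot x x) @^-1` `]-oo, 1[%classic); last first.
  by apply/seteqP; split=> x /=; rewrite in_itv.
by apply: measurable_preimage => //; apply: measurable_dot.
Qed.

Let lebesgue3_ball1 :
  exists2 b, 0 < b & lebesgue3 ball1 = b%:E.
Proof.
have mC := measurable_cube; have cubeB : cube 2^-1 `<=` ball1.
  move=> x /cubeP h; rewrite /ball1 /= /dot.
  have h2 i : x 0 i * x 0 i <= 4^-1.
    rewrite -expr2 -real_normK ?num_real//.
    rewrite (_ : 4^-1 = 2^-1 ^+ 2 :> R); last by rewrite exprVn -natrX.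
    by rewrite lerXn2r ?nnegrE ?invr_ge0// ltW// h.
  rewrite !big_ord_recr big_ord0/= add0r.
  apply: le_lt_trans (_ : 4^-1 + 4^-1 + 4^-1 < 1).
    by rewrite !lerD.
  by lra.
have Bcube : ball1 `<=` cube 1.
  move=> x; rewrite /ball1 /= => x1; apply/cubeP => i.
  rewrite -(@ltr_pXn2r _ 2)// ?nnegrE// expr1n real_normK ?num_real//.
  apply: le_lt_trans x1; rewrite /dot (bigD1 i)//= -expr2 lerDl sumr_ge0// => j _.
  by rewrite -expr2 sqr_ge0.
have fB : lebesgue3 ball1 \is a fin_num.
  rewrite ge0_fin_numE//; apply: (@le_lt_trans _ _ (lebesgue3 (cube 1))).
    by apply: le_measure; rewrite ?inE.
  by rewrite lebesgue3_cube// ltry.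
exists (fine (lebesgue3 ball1)); last by rewrite fineK.
rewrite fine_gt0// -ge0_fin_numE// fB andbT.
apply: (@lt_le_trans _ _ (lebesgue3 (cube 2^-1))).
  by rewrite lebesgue3_cube ?invr_ge0// lte_fin exprn_gt0// pmulrn_lgt0.
by apply: le_measure; rewrite ?inE.
Qed.

(** With [B] the unit ball, [dx(T^-1 A) dx(B)] is by [integral_sheared_section] the
    integral over [y] of the measure of [{z | A (zQ) /\ B (y - zQ)}]. The translation
    of [z] by [y Q^T] turns this set into [{z | A (zQ + y) /\ B (- zQ)}], and
    [B (- zQ)] amounts to [B z]. Hence the integral is also [dx(B) dx(A)], and the
    finite positive factor [dx(B)] cancels. *)
Lemma preserves_orthogonal (Q : 'M[R]_3) : Q *m Q^T = 1%:M ->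
  preserves lebesgue3 (fun x => x *m Q).
Proof.
move=> QQT; have mQ := measurable_mulmxr Q; split=> [|A mA]; first exact: mQ.
have [b b0 lB] := lebesgue3_ball1.
have mAQ : measurable ((fun x => x *m Q) @^-1` A) by exact: measurable_preimage.
have mNQ : measurable_fun setT (fun x : 'rV[R]_3 => x *m - Q).
  exact: measurable_mulmxr.
have := integral_sheared_section preserves_shift3 mAQ measurable_ball1 mNQ.
rewrite (_ : (\int[_]_y _)%E = (lebesgue3 ball1 * lebesgue3 A)%E); last first.
  rewrite -(integral_sheared_section preserves_shift3 measurable_ball1 mA mQ); apply: eq_integral => y _.
  have [_ preS] := preserves_shift3 (y *m Q^T).
  rewrite -[LHS]preS; last first.
    apply: measurableI => //.
    apply: (@measurable_preimage _ _ _ _ (fun z : 'rV[R]_3 => y + z *m - Q)) => //.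
    apply: (eq_measurable_fun ((fun z => z + y) \o (fun z => z *m - Q))).
      by move=> z _; rewrite /= addrC.
    exact: measurableT_comp (preserves_shift3 y).1 mNQ.
  have QTQ : Q^T *m Q = 1%:M by exact: mulmx1C.
  have EA z : (z + y *m Q^T) *m Q = y + z *m Q.
    by rewrite mulmxDl -mulmxA QTQ mulmx1 addrC.
  have EB z : ball1 (y + (z + y *m Q^T) *m - Q) = ball1 z.
    rewrite mulmxN EA opprD addNKr -mulNmx /ball1 /= dot_mulmxr//.
    congr (_ < 1); apply: eq_bigr => i _; by rewrite !mxE mulrNN.
  congr lebesgue3; apply/seteqP; split=> z /=; rewrite EA EB => -[? ?]; by split.
move=> AB; apply: (mule_cancel b0).
by rewrite -lB.
Qed.

End lebesgue3_invariance.

(** * Invariance of the reference measure *)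

Section rotations.
Context (R : realType) (Q : 'M[R]_3).
Hypothesis QQT : Q *m Q^T = 1%:M.

Let QTQ : Q^T *m Q = 1%:M. Proof. exact: mulmx1C. Qed.

Lemma mulmxr_orthogonalK n : cancel (fun x : 'M[R]_(n, 3) => x *m Q) (mulmxr Q^T).
Proof. by move=> x; rewrite /= -mulmxA QQT mulmx1. Qed.

Lemma mulmxr_orthogonalVK n : cancel (mulmxr Q^T) (fun x : 'M[R]_(n, 3) => x *m Q).
Proof. by move=> x; rewrite /= -mulmxA QTQ mulmx1. Qed.

Lemma integral_rotation (m : {measure set 'rV[R]_3 -> \bar R}) (f : 'rV[R]_3 -> \bar R) :
  preserves m (fun x => x *m Q) -> (\int[m]_x f (x *m Q) = \int[m]_x f x)%E.
Proof.
move=> [mQ mE].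
apply: (integral_comp_iso f mQ (measurable_mulmxr Q^T)) => //.
  exact: mulmxr_orthogonalK.
exact: mulmxr_orthogonalVK.
Qed.

Lemma Rintegral_rotation (m : {measure set 'rV[R]_3 -> \bar R}) (f : 'rV[R]_3 -> R) :
  preserves m (fun x => x *m Q) -> \int[m]_x f (x *m Q) = \int[m]_x f x.
Proof. by move=> mQ; congr fine; exact: (integral_rotation (EFin \o f)). Qed.

Lemma psi_rotation gamma (x : 'rV[R]_3) : psi gamma (x *m Q) = psi gamma x.
Proof. by rewrite /psi /enorm dot_mulmxr. Qed.

Lemma preserves_refm gamma : preserves (refm gamma) (fun x => x *m Q).
Proof.
have mQ := measurable_mulmxr Q; split=> [|A mA]; first exact: mQ.
rewrite /refm integral_mkcond [RHS]integral_mkcond.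
rewrite -[RHS](integral_rotation _ (preserves_orthogonal QQT)).
by apply: eq_integral => x _; rewrite !patchE psi_rotation.
Qed.

End rotations.

(** * The flat function exp(-1/t) *)

Section flat.
Context (R : realType).
Implicit Types (t : R) (n : nat).

(** The factors [t^-n] make the family closed under differentiation up to linear
    combinations, see [is_derive_flat]; [flat 0] is the usual flat function. *)
Definition flat n t : R := if 0 < t then t^-1 ^+ n * expR (- t^-1) else 0.

Lemma flat_ge0 n t : 0 <= flat n t.
Proof.
by rewrite /flat; case: ifP => // t0; rewrite mulr_ge0 ?expR_ge0// exprn_ge0// invr_ge0 ltW.
Qed.

(** The difference quotient of [flat n] at the origin is [flat n.+1], so this bound
    for all [n] gives a zero derivative there. It comes from
    [s ^ (n+1) / (n+1)! <= exp s] with [s = 1/t]. *)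
Lemma flat_le n t : flat n t <= n.+1`!%:R * `|t|.
Proof.
rewrite /flat; case: ifPn => [t0|_]; last by rewrite mulr_ge0.
have s0 : 0 < t^-1 by rewrite invr_gt0.
rewrite gtr0_norm// -ler_pdivrMr//.
rewrite mulrAC -exprSr expRN ler_pdivrMr ?expR_gt0//.
rewrite -ler_pdivrMl ?ltr0n ?fact_gt0// mulrC.
by apply: le_trans (expR_ge1Dxn n (ltW s0)); rewrite lerDr.
Qed.

Lemma flatS n t : flat n.+1 t = t^-1 * flat n t.
Proof. by rewrite /flat; case: ifP => _; rewrite ?mulr0// exprS mulrA. Qed.

Lemma is_derive_flat n t :
  is_derive t 1 (flat n) (flat n.+2 t - n%:R * flat n.+1 t).
Proof.
have [t0|t0|->] := ltgtP t 0.
- rewrite /flat ltNge (ltW t0)/= mulr0 subr0.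
  apply: near_eq_is_derive (is_derive_cst 0 t 1).
  near=> s; rewrite /flat ltNge ltW//; near: s.
  exact: lt_nbhsl.
- pose f s : R := s^-1 ^+ n * expR (- s^-1).
  apply: (@near_eq_is_derive _ _ _ f).
    by near=> s; rewrite /flat ifT//; near: s; exact: lt_nbhsr.
  have dV : is_derive t 1 (fun s : R => s^-1) (- t ^- 2).
    by apply: is_derive_eq (@is_deriveV R id t 1 1 (lt0r_neq0 t0) _) (mulr1 _).
  have dX := is_deriveX n dV.
  have dE := @is_derive1_comp R expR (fun s => - s^-1) t _ _
    (is_derive_expR _) (is_deriveN dV).
  have -> : f = (fun s => s^-1) ^+ n * (expR \o (fun s => - s^-1)).
    by apply/funext => s; rewrite /f !fctE.
  apply: is_derive_eq (is_deriveM dX dE) _.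
  rewrite /flat t0 opprK /= -exprVn.
  set E := expR _; set s := t^-1; rewrite [X in X *: _](_ : _ = s ^+ n); last by rewrite fctE.
  have scE (a b : R) : a *: (b : R^o) = a * b by [].
  rewrite !scE.
  (* [n%:R * s ^+ n.-1] is the derivative of [s ^+ n]; for [n = 0] the factor [n%:R]
     makes up for the truncated predecessor. *)
  have key (a b : R) : s ^+ n * (a * s ^+ 2) + a * (n%:R * s ^+ n.-1 * - b) =
      s ^+ n.+2 * a - n%:R * (s ^+ n.-1 * b * a).
    by rewrite !exprS; ring.
  rewrite key; congr (_ - _); case: n {f dX key} => [|m]; first by rewrite !mul0r.
  by rewrite /= -exprD addn2.
- rewrite /flat ltxx mulr0 subr0.
  have D0 : (fun h => h^-1 *: ((flat n \o shift 0) (h *: 1) - flat n 0)) @ 0^' --> (0 : R).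
    rewrite (_ : (fun h => _) = flat n.+1); last first.
      apply/funext => h; rewrite /= addr0 [flat n 0]/flat ltxx subr0.
      by rewrite [h *: 1]mulr1 flatS.
    apply/cvgr0Pnorm_le => e e0; near=> h.
    rewrite ger0_norm ?flat_ge0// (le_trans (flat_le _ _))// mulrC.
    rewrite -ler_pdivlMr ?ltr0n ?fact_gt0//.
    near: h; apply: dnbhs0_le; first by rewrite divr_gt0// ltr0n fact_gt0.
  by apply: DeriveDef; [apply: cvgP D0|exact: cvg_lim D0].
Unshelve. all: by end_near. Qed.

End flat.

(** * Closure properties of smooth functions *)

Section Ck.
Context (R : realType).
Implicit Types (f g phi : 'rV[R]_3 -> R) (k : nat).

Lemma CkS k f : Ck k.+1 f -> Ck k f.
Proof.
elim: k f => [|k IH] f [df Df]; first by move=> x; exact: differentiable_continuous.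
by split=> // e; exact: IH.
Qed.

Lemma Ck_cst k (c : R) : Ck k (cst c).
Proof.
elim: k c => [|k IH] c; first exact: cst_continuous.
split=> [x|e]; first exact: differentiable_cst.
by rewrite (_ : 'D_e (cst c) = cst 0)//; apply/funext => x; rewrite derive_cst.
Qed.

Lemma CkD k f g : Ck k f -> Ck k g -> Ck k (f + g).
Proof.
elim: k f g => [|k IH] f g; first by move=> cf cg x; apply: (continuousD (cf x) (cg x)).
move=> [df Df] [dg Dg]; split=> [x|e]; first exact: differentiableD.
rewrite (_ : 'D_e (f + g) = 'D_e f + 'D_e g); first exact: (IH _ _ (Df e) (Dg e)).
by apply/funext => x; rewrite deriveD//; exact: diff_derivable.
Qed.

Lemma CkM k f g : Ck k f -> Ck k g -> Ck k (f * g).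
Proof.
elim: k f g => [|k IH] f g; first by move=> cf cg x; apply: (continuousM (cf x) (cg x)).
move=> Cf Cg; have [[df Df] [dg Dg]] := (Cf, Cg).
split=> [x|e]; first exact: differentiableM.
rewrite (_ : 'D_e (f * g) = f * 'D_e g + g * 'D_e f).
  by apply: CkD; apply: IH; [exact: CkS|exact: Dg|exact: CkS|exact: Df].
by apply/funext => x; rewrite deriveM//; exact: diff_derivable.
Qed.

Lemma Ck_coord k (i : 'I_3) : Ck k (fun x : 'rV[R]_3 => x 0 i).
Proof.
case: k => [|k]; first exact: coord_continuous.
split=> [x|e]; first exact: differentiable_coord.
rewrite (_ : 'D_e _ = cst (e 0 i)); first exact: Ck_cst.
apply/funext => x; apply/cvg_lim => //; apply: cvg_near_cst.
near=> h; rewrite /= !mxE addrK scalerA mulVf ?scale1r//.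
by near: h; exact: nbhs_dnbhs_neq.
Unshelve. all: by end_near. Qed.

Lemma Ck_flat k n f : Ck k f -> Ck k (flat n \o f).
Proof.
elim: k n f => [|k IH] n f.
  move=> cf x; apply: continuous_comp; first exact: cf.
  apply: differentiable_continuous; apply/derivable1_diffP.
  by have [] := is_derive_flat n (f x).
move=> Cf; have [df Df] := Cf.
have dflat t : differentiable (@flat R n) t.
  by apply/derivable1_diffP; have [] := is_derive_flat n t.
split=> [x|e]; first exact: (differentiable_comp (df x) (dflat (f x))).
rewrite (_ : 'D_e _ = (flat n.+2 \o f + cst (- n%:R) * (flat n.+1 \o f)) * 'D_e f).
  apply: CkM (Df e).
  by apply: CkD; [|apply: CkM; [exact: Ck_cst|]]; apply: IH; exact: CkS.
apply/funext => x; rewrite deriveE; last exact: (differentiable_comp (df x) (dflat (f x))).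
rewrite (diff_comp (df x) (dflat (f x)))/= diff1E// -deriveE// derive1E.
have [_ ->] := is_derive_flat n (f x).
by rewrite -mulNr [LHS]mulrC.
Qed.

Lemma derive_mulmxr (Q : 'M[R]_3) f e :
  'D_e (fun x => f (x *m Q)) = (fun x => 'D_(e *m Q) f (x *m Q)).
Proof.
apply/funext => x; rewrite /derive.
by under eq_fun do rewrite /= mulmxDl -scalemxAl.
Qed.

End Ck.

(** * Test functions *)

Section test_functions.
Context (R : realType).
Implicit Types (f phi : 'rV[R]_3 -> R).

Lemma Ck_mulmxr (Q : 'M[R]_3) k f : Ck k f -> Ck k (fun x => f (x *m Q)).
Proof.
elim: k f => [|k IH] f.
  move=> cf x; apply: (@continuous_comp _ _ _ (fun x : 'rV[R]_3 => x *m Q) f).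
    exact: continuous_mulmxr.
  exact: cf.
move=> [df Df]; split=> [x|e].
  exact: (differentiable_comp (differentiable_mulmxr Q x) (df _)).
by rewrite derive_mulmxr; exact: (IH _ (Df (e *m Q))).
Qed.

Lemma test_function_rotation (Q : 'M[R]_3) phi : Q *m Q^T = 1%:M ->
  test_function phi -> test_function (fun x => phi (x *m Q)).
Proof.
move=> QQT [Cphi [K cK phiK]]; split=> [k|]; first exact: (Ck_mulmxr Q (Cphi k)).
exists ((fun x => x *m Q^T) @` K).
  apply: continuous_compact => //; apply: continuous_subspaceT.
  exact: continuous_mulmxr.
move=> x Kx; apply: phiK => Kx'; apply: Kx; exists (x *m Q) => //.
by rewrite -mulmxA QQT mulmx1.
Qed.

Lemma test_function_derive e phi : test_function phi -> test_function ('D_e phi).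
Proof.
move=> [Cphi [K cK phiK]]; split=> [k|].
  by have [_] := Cphi k.+1; exact.
exists K => // x Kx; rewrite -(derive_cst 0 x e); apply: near_eq_derive.
have oK : nbhs x (~` K).
  by apply: open_nbhs_nbhs; split=> //; apply: closed_openC; exact: compact_closed.
near=> y; apply: phiK; near: y; exact: oK.
Unshelve. all: by end_near. Qed.

Lemma test_function_continuous phi : test_function phi -> continuous phi.
Proof. by move=> [/(_ 0%N)]. Qed.

(** Written as a product of compositions of smooth functions so that smoothness
    is read off the term; [box_bumpE] gives the readable formula. *)
Definition box_bump (c : 'rV[R]_3) (r : R) : 'rV[R]_3 -> R :=
  \prod_(i < 3) (flat 0 \o (cst (r ^+ 2) + cst (- 1) *
     ((fun x : 'rV[R]_3 => x 0 i) + cst (- c 0 i)) * ((fun x : 'rV[R]_3 => x 0 i) + cst (- c 0 i)))).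

Lemma box_bumpE c r x : box_bump c r x = \prod_(i < 3) flat 0 (r ^+ 2 - (x 0 i - c 0 i) ^+ 2).
Proof.
rewrite /box_bump fct_prodE; apply: eq_bigr => i _ /=; congr flat.
by rewrite !fctE mulN1r -mulNr expr2 mulNr.
Qed.

Lemma flat0_gt0 (t : R) : (0 < flat 0 t) = (0 < t).
Proof. by rewrite /flat; case: ifP; rewrite ?ltxx// mul1r expR_gt0. Qed.

Lemma box_bump_gt0 c r x : 0 < r -> (0 < box_bump c r x) <-> ball c r x.
Proof.
move=> r0; rewrite box_bumpE lt0r prodr_ge0 ?andbT; last by move=> i _; exact: flat_ge0.
have E i : (flat 0 (r ^+ 2 - (x 0 i - c 0 i) ^+ 2) != 0) = (`|c 0 i - x 0 i| < r).
  rewrite -[LHS]andbT -(flat_ge0 0 (r ^+ 2 - (x 0 i - c 0 i) ^+ 2)) -lt0r flat0_gt0.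
  rewrite subr_gt0 -[in LHS]real_normK ?num_real// ltr_pXn2r ?nnegrE ?normr_ge0 ?(ltW r0)//.
  by rewrite distrC.
split.
  move/prodf_neq0 => h; split=> // i j; rewrite ord1.
  by have := h j isT; rewrite E.
by move=> [_ h]; apply/prodf_neq0 => i _; rewrite E; exact: h.
Qed.

Lemma test_function_box_bump c r : 0 < r -> test_function (box_bump c r).
Proof.
move=> r0; split=> [k|].
  apply: (big_ind (Ck k)); first exact: Ck_cst.
    exact: CkM.
  move=> i _; apply: Ck_flat; apply: CkD; first exact: Ck_cst.
  by apply: CkM; [apply: CkM; first exact: Ck_cst|];
    (apply: CkD; [exact: Ck_coord|exact: Ck_cst]).
exists [set v : 'rV[R]_3 | forall i, `[c 0 i - r, c 0 i + r]%classic (v 0 i)].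
  by apply: (@rV_compact _ _ (fun i => `[c 0 i - r, c 0 i + r]%classic)) => i; exact: segment_compact.
move=> x; apply: contra_notP => /eqP b0 i /=.
have /(box_bump_gt0 c x r0)[_ xr] : 0 < box_bump c r x.
  by rewrite lt0r b0 box_bumpE prodr_ge0// => j _; exact: flat_ge0.
have : `|c 0 i - x 0 i| < r by exact: xr.
by rewrite in_itv/= ltr_distlC => /andP[? ?]; rewrite !ltW.
Qed.

(** Multiplying [phi] by a large constant before applying [exp(-1/t)] pushes the
    value to 1 wherever [phi] is positive and keeps it 0 elsewhere: the sequence
    converges to the indicator of [{phi > 0}] without enlarging the support. *)
Definition mollify phi n : 'rV[R]_3 -> R := flat 0 \o (cst n.+1%:R * phi).

Lemma mollifyE phi n x : 0 < phi x ->
  mollify phi n x = expR (- (n.+1%:R^-1 * (phi x)^-1)).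
Proof.
move=> p0; rewrite /mollify /= /flat [(_ * _) x]/(n.+1%:R * phi x).
by rewrite pmulr_rgt0 ?ltr0n// p0 mul1r invfM.
Qed.

Lemma mollify0 phi n x : phi x <= 0 -> mollify phi n x = 0.
Proof.
move=> p0; rewrite /mollify /= /flat [(_ * _) x]/(n.+1%:R * phi x).
by rewrite pmulr_rgt0 ?ltr0n// ltNge p0.
Qed.

Lemma mollify_ge0 phi n x : 0 <= mollify phi n x.
Proof. exact: flat_ge0. Qed.

Lemma mollify_le1 phi n x : mollify phi n x <= 1.
Proof.
have [p0|p0] := leP (phi x) 0; first by rewrite mollify0.
by rewrite mollifyE// expR_le1 oppr_le0 mulr_ge0// invr_ge0 ?ler0n// ltW.
Qed.

Lemma test_function_mollify phi n : test_function phi -> test_function (mollify phi n).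
Proof.
move=> [Cphi [K cK phiK]]; split=> [k|].
  by apply: Ck_flat; apply: CkM (Cphi k); exact: Ck_cst.
by exists K => // x /phiK px; rewrite mollify0// px.
Qed.

Lemma cvg_mollify phi x : (forall y, 0 <= phi y) ->
  mollify phi n x @[n --> \oo] --> (\1_[set y | 0 < phi y] x : R).
Proof.
move=> phi0; have [px|px] := ltP 0 (phi x); last first.
  rewrite indicE memNset /=; last by rewrite ltNge px.
  by under eq_fun do rewrite mollify0//; exact: cvg_cst.
rewrite indicE mem_set//=; under eq_fun do rewrite mollifyE//.
have h0 : - (n.+1%:R^-1 * (phi x)^-1) @[n --> \oo] --> (0 : R).
  rewrite -oppr0; apply: cvgN; rewrite -(mul0r (phi x)^-1); apply: cvgMl.
  exact: cvg_harmonic.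
have := @continuous_cvg _ _ _ _ _ _ expR _ (@continuous_expR R 0) h0.
by rewrite expR0; apply.
Qed.

End test_functions.

(** * Local integrability of the elements of L^2(m) *)

Lemma ge0_le_restr_integral d (T : measurableType d) (R : realType)
    (mu nu : {measure set T -> \bar R}) (D : set T) (c : R) (f : T -> \bar R) :
    measurable D -> 0 < c ->
    (forall A, measurable A -> c%:E * mu (A `&` D) <= nu A)%E ->
    measurable_fun setT f -> (forall x, 0 <= f x)%E ->
  (c%:E * \int[mu]_(x in D) f x <= \int[nu]_(x in D) f x)%E.
Proof.
move=> mD c0 munu mf f0.
pose k := NngNum (ltW c0); pose m1 := mscale k (mrestr mu mD).
have m1E : (\int[m1]_(x in D) f x = c%:E * \int[mu]_(x in D) f x)%E.
  rewrite (ge0_integral_mscale (mrestr mu mD) mD k (measurable_funTS mf) (fun x _ => f0 x)).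
  congr (_ * _)%E; apply: eq_measure_integral => A mA AD.
  by rewrite [LHS]/(mu (A `&` D)) setIidl.
by rewrite -m1E; apply: ge0_le_measure_integral.
Qed.

Section local_integrability.
Context (R : realType).
Implicit Types (x : 'rV[R]_3) (u g : 'rV[R]_3 -> R).

Definition integrable_on_cubes u : Prop :=
  forall n, (@lebesgue3 R).-integrable (cube n.+1%:R) (EFin \o u).

Lemma enorm_gt0 x : x != 0 -> 0 < enorm x.
Proof.
move=> x0; rewrite sqrtr_gt0 lt0r sumr_ge0 ?andbT; last first.
  by move=> i _; rewrite -expr2 sqr_ge0.
apply: contra x0 => /eqP /psumr_eq0P d0; apply/eqP/rowP => i; rewrite mxE.
have : x 0 i * x 0 i = 0.
  by apply: d0 => // j _; rewrite -expr2 sqr_ge0.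
by move/eqP; rewrite mulf_eq0 orbb => /eqP.
Qed.

Lemma enorm_cube x r : 0 <= r -> cube r x -> enorm x <= 2 * r.
Proof.
move=> r0 /cubeP xr; rewrite -[leRHS]ger0_norm ?mulr_ge0// -sqrtr_sqr.
rewrite ler_wsqrtr// /dot.
have h i : x 0 i * x 0 i <= r ^+ 2.
  rewrite -expr2 -real_normK ?num_real// lerXn2r ?nnegrE ?normr_ge0//.
  exact/ltW/xr.
have h0 := h 0; have h1 := h 1; have h2 := h 2%:R.
rewrite big_ord_recr big_ord_recr big_ord_recr big_ord0 /= add0r.
apply: le_trans (_ : r ^+ 2 + r ^+ 2 + r ^+ 2 <= _).
  by rewrite !lerD.
by rewrite exprMn; have := sqr_ge0 r; lra.
Qed.

Lemma lebesgue3_origin : lebesgue3 [set (0 : 'rV[R]_3)] = 0%E.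
Proof.
have -> : [set (0 : 'rV[R]_3)] = box (fun=> [set 0]).
  apply/seteqP; split=> [x /= -> i /=|x h]; first by rewrite mxE.
  by apply/rowP => i; rewrite mxE; exact: h.
by rewrite lebesgue3_box// lebesgue_measure_set1 !mul0e.
Qed.

Lemma measurable_origin : measurable [set (0 : 'rV[R]_3)].
Proof.
have -> : [set (0 : 'rV[R]_3)] = box (fun=> [set 0]).
  apply/seteqP; split=> [x /= -> i /=|x h]; first by rewrite mxE.
  by apply/rowP => i; rewrite mxE; exact: h.
by apply: measurable_box => i; exact: measurable_set1.
Qed.

Context (gamma : R) (gamma_gt0 : 0 < gamma).

(** The origin is excluded because there the formula for [psi] divides by zero and
    yields the value 0. *)
Lemma psi_lower_bound r : 0 < r -> exists2 c, 0 < c &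
  forall x, cube r x -> x != 0 -> c <= psi gamma x ^+ 2.
Proof.
move=> r0; pose a := Num.sqrt gamma / Num.sqrt (2 * pi).
have a0 : 0 < a by rewrite divr_gt0// sqrtr_gt0// mulr_gt0// pi_gt0.
pose b := a * (expR (- gamma * (2 * r)) / (2 * r)).
have b0 : 0 < b by rewrite mulr_gt0// divr_gt0 ?expR_gt0// mulr_gt0.
exists (b ^+ 2); first by rewrite exprn_gt0.
move=> x xr x0; have e0 := enorm_gt0 x0; have er := enorm_cube (ltW r0) xr.
have bpsi : b <= psi gamma x.
  rewrite /psi -/a ler_pM2l// ler_pM ?expR_ge0 ?invr_ge0 ?mulr_ge0 ?(ltW r0)//.
    by rewrite ler_expR ler_nM2l// oppr_lt0.
  by rewrite lef_pV2// posrE mulr_gt0.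
by rewrite lerXn2r// nnegrE ltW// (lt_le_trans b0).
Qed.

Lemma refm_lower_bound r : 0 < r -> exists2 c, 0 < c &
  forall A, measurable A -> (c%:E * lebesgue3 (A `&` cube r) <= refm gamma A)%E.
Proof.
move=> r0; have [c c0 cpsi] := psi_lower_bound r0; exists c => // A mA.
have mC := measurable_cube (r : R).
set B := A `&` cube r; have mB : measurable B by exact: measurableI.
pose B' := B `\ 0; have mB' : measurable B'.
  by apply: measurableD => //; exact: measurable_origin.
have mpsi : measurable_fun setT (fun x => (psi gamma x ^+ 2)%:E).
  apply/measurable_EFinP; apply: measurable_funX; exact: measurable_psi.
(* The bound on the density fails at the origin, which is a null set. *)
have -> : lebesgue3 B = lebesgue3 B'.
  apply/eqP; rewrite eq_le; apply/andP; split; last first.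
    by apply: le_measure; rewrite ?inE//; exact: subDsetl.
  rewrite -[leRHS]adde0 -lebesgue3_origin.
  apply: (@le_trans _ _ (lebesgue3 (B' `|` [set 0]))).
    apply: le_measure; rewrite ?inE//.
      by apply: measurableU => //; exact: measurable_origin.
    by move=> x Bx; have [->|/eqP x0] := eqVneq x 0; [right|left].
  by apply: measureU2 => //; exact: measurable_origin.
rewrite -integral_cst// /refm.
apply: (@le_trans _ _ (\int[lebesgue3]_(x in B') (psi gamma x ^+ 2)%:E)%E).
  apply: ge0_le_integral => //.
  - by move=> x _; rewrite lee_fin ltW.
  - exact: measurable_funTS.
  - by move=> x [[_ xr] /eqP x0]; rewrite lee_fin; exact: cpsi.
apply: ge0_subset_integral => //.
- exact: measurable_funTS.
- by move=> x _; rewrite lee_fin sqr_ge0.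
- by move=> x [[]].
Qed.

Lemma ge0_integral_cube_le r : 0 < r -> exists2 c, 0 < c &
  forall f : 'rV[R]_3 -> \bar R, measurable_fun setT f -> (forall x, 0 <= f x)%E ->
  (c%:E * \int[lebesgue3]_(x in cube r) f x <= \int[refm gamma]_x f x)%E.
Proof.
move=> r0; have [c c0 cm] := refm_lower_bound r0; exists c => // f mf f0.
have mC := measurable_cube (r : R).
apply: (@le_trans _ _ (\int[refm gamma]_(x in cube r) f x)%E).
  exact: ge0_le_restr_integral.
by apply: ge0_subset_integral.
Qed.

Lemma L2_measurable u : L2 gamma u -> measurable_fun setT u.
Proof. by rewrite /L2 /= inE => /andP[/[!inE]/=]. Qed.

(** On a cube [dx] is bounded by a multiple of [m], hence [u^2] is integrable for
    [dx], and [|u| <= 1 + u^2]. *)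
Lemma L2_integrable_on_cubes u : L2 gamma u -> integrable_on_cubes u.
Proof.
move=> L2u n; have mu := L2_measurable L2u.
have mC := measurable_cube (n.+1%:R : R).
have [c c0 cint] := @ge0_integral_cube_le n.+1%:R (ltr0Sn _ _).
have mu2 : measurable_fun setT (fun x => (u x ^+ 2)%:E).
  by apply/measurable_EFinP; apply: measurable_funX.
have iu2 : (@lebesgue3 R).-integrable (cube n.+1%:R) (fun x => (u x ^+ 2)%:E).
  apply/integrableP; split; first exact: measurable_funTS.
  have /integrableP[_] := Lfun2_integrable_sqr L2u.
  under eq_integral do rewrite gee0_abs ?lee_fin ?sqr_ge0//.
  under [X in _ -> (X < _)%E]eq_integral do rewrite gee0_abs ?lee_fin ?sqr_ge0//.
  move=> u2oo.
  have u2_ge0 x : (0 <= (u x ^+ 2)%:E)%E by rewrite lee_fin sqr_ge0.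
  have := le_lt_trans (cint _ mu2 u2_ge0) u2oo.
  rewrite -(@lte_pmul2l _ c^-1%:E) ?lte_fin ?invr_gt0// muleA -EFinM mulVf ?gt_eqF//.
  by rewrite mul1e gt0_muley// lte_fin invr_gt0.
have i1 : (@lebesgue3 R).-integrable (cube n.+1%:R) (fun x => 1%:E).
  apply/integrableP; split=> //.
  under eq_integral do rewrite abse1.
  rewrite (_ : (\int[_]_(x in _) _)%E = ((n.+1%:R *+ 2) ^+ 3)%:E) ?ltry//.
  rewrite -lebesgue3_cube// -[RHS]mul1e.
  exact: integral_cst.
apply: (le_integrable mC _ _ (integrableD mC i1 iu2)).
  by apply: measurable_funTS; apply/measurable_EFinP.
move=> x _ /=; rewrite lee_fin [leRHS]ger0_norm ?addr_ge0 ?sqr_ge0//.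
rewrite -[u x ^+ 2]real_normK ?num_real//.
have := sqr_ge0 (`|u x| - 1); have := normr_ge0 (u x); nra.
Qed.

End local_integrability.

(** * Uniqueness of weak gradients *)

Section ae_eq_pi_system.
Context d (T : measurableType d) (R : realType).
Variable mu : {measure set T -> \bar R}.

(** The sets over whose intersection with [D] both functions have the same integral
    form a Dynkin class, so that equality on the pi-system [C] extends to all
    measurable subsets of [D]. *)
Lemma ae_eq_pi_system (C : set (set T)) (D : set T) (f g : T -> \bar R) :
    @measurable _ T = <<s C >> -> setI_closed C -> C D ->
    mu.-integrable D f -> mu.-integrable D g ->
    (forall U, C U -> U `<=` D -> \int[mu]_(x in U) f x = \int[mu]_(x in U) g x)%E ->
  ae_eq mu D f g.
Proof.
move=> mC CI CD fi gi fg.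
have mD : measurable D by rewrite mC; exact: sub_sigma_algebra.
have [mf mg] := (measurable_int _ fi, measurable_int _ gi).
pose P E := (\int[mu]_(x in D `&` E) f x = \int[mu]_(x in D `&` E) g x)%E.
have fgD : (\int[mu]_(x in D) f x = \int[mu]_(x in D) g x)%E by exact: fg.
suff PE E : <<s C >> E -> P E.
  apply: integral_ae_eq => // E ED mE; rewrite -(setIidr ED); apply: PE.
  by rewrite -mC.
apply: (dynkin_induction mC CI) => //.
- by rewrite /P setIT.
- by move=> U CU; apply: fg; [exact: CI|exact: subIsetl].
- move=> S mS PS.
  have split (h : T -> \bar R) : mu.-integrable D h ->
      (\int[mu]_(x in D) h x = \int[mu]_(x in D `&` S) h x +
                               \int[mu]_(x in D `&` ~` S) h x)%E.
    move=> hi; rewrite -integral_setU -?setIUr ?setUv ?setIT//.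
    + exact: measurableI.
    + by apply: measurableI => //; exact: measurableC.
    + exact: measurable_int hi.
    + by apply/disj_setPS => x [[_ Sx] [_ /(_ Sx)]].
  have fin (h : T -> \bar R) : mu.-integrable D h ->
      (\int[mu]_(x in D `&` S) h x)%E \is a fin_num.
    move=> hi; apply: integrable_fin_num; first exact: measurableI.
    by apply: integrableS hi => //; exact: measurableI.
  have := fgD; rewrite (split _ fi) (split _ gi) -PS.
  have := fin _ fi; rewrite /P.
  move: (\int[mu]_(x in D `&` S) f x)%E (\int[mu]_(x in D `&` ~` S) f x)%E => a b.
  move: (\int[mu]_(x in D `&` ~` S) g x)%E => c afin abc.
  by rewrite -(addeK b afin) -(addeK c afin) ![(_ + a)%E]addeC abc.
- move=> F mF tF PF; rewrite /P setI_bigcupr.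
  rewrite !integral_bigcup//.
  + by apply: eq_eseriesr => n _; exact: PF.
  + exact: trivIset_setIl.
  + by move=> n; exact: measurableI.
  + by rewrite -setI_bigcupr; apply: integrableS gi => //; apply: measurableI => //; exact: bigcup_measurable.
  + exact: trivIset_setIl.
  + by move=> n; exact: measurableI.
  + by rewrite -setI_bigcupr; apply: integrableS fi => //; apply: measurableI => //; exact: bigcup_measurable.
Qed.

End ae_eq_pi_system.

Section du_bois_reymond.
Context (R : realType).
Implicit Types (x : 'rV[R]_3) (g h phi : 'rV[R]_3 -> R).

Lemma cube_cover x : exists n, cube n.+1%:R x.
Proof.
exists (Num.trunc (\sum_i `|x 0 i|)); apply/cubeP => i.
apply: le_lt_trans (truncnS_gt _).
by rewrite (bigD1 i)//= lerDl sumr_ge0.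
Qed.

(** Open sets whose indicator is the limit of the test functions [mollify phi n]. An
    intersection of two of them corresponds to the product of the two functions. *)
Definition positivity_sets : set (set 'rV[R]_3) :=
  [set U | exists phi, [/\ test_function phi, (forall x, 0 <= phi x) &
                           U = [set x | 0 < phi x]]].

Lemma positivity_setsI : setI_closed positivity_sets.
Proof.
move=> _ _ [f [[Cf [K cK fK]] f0 ->]] [g [[Cg _] g0 ->]].
exists (f * g); split.
- split=> [k|]; first exact: (CkM (Cf k) (Cg k)).
  exists K => // x /fK fx0; rewrite [LHS](_ : _ = f x * g x)//.
  by rewrite fx0 mul0r.
- by move=> x; exact: mulr_ge0.
- apply/seteqP; split=> x /=; rewrite [(f * g) x](_ : _ = f x * g x)//.
    by move=> [fx gx]; exact: mulr_gt0.
  by rewrite !lt0r mulf_eq0 negb_or f0 g0 => /andP[/andP[-> ->]].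
Qed.

Lemma positivity_sets_cube n : positivity_sets (cube n.+1%:R).
Proof.
have n0 : 0 < n.+1%:R :> R by [].
exists (box_bump 0 n.+1%:R); split.
- exact: test_function_box_bump.
- by move=> x; rewrite box_bumpE prodr_ge0// => i _; exact: flat_ge0.
apply/seteqP; split=> x /=.
  move=> /cubeP h; apply/(box_bump_gt0 _ _ n0); split=> // i j.
  by rewrite ord1 /ball /= mxE sub0r normrN.
move=> /(box_bump_gt0 _ _ n0)[_ h]; apply/cubeP => i.
by have := h 0 i; rewrite /ball /= mxE sub0r normrN.
Qed.

(** Open half-spaces [{x | a < x_i}], cut by cubes, are positivity sets: the
    coordinates are therefore measurable for the sigma-algebra generated by the
    positivity sets, and so are the Borel sets. *)
Lemma measurable_positivity_sets : @measurable _ 'rV[R]_3 = <<s positivity_sets >>.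
Proof.
apply/seteqP; split; last first.
  apply: smallest_sub; first exact: sigma_algebra_measurable.
  move=> _ [phi [tphi _ ->]]; apply: open_measurable_rV.
  rewrite (_ : [set x | _] = phi @^-1` [set t | 0 < t])//.
  apply: open_comp; last exact: open_gt.
  by move=> x _; exact: test_function_continuous.
have mid : measurable_fun setT (fun x : g_sigma_algebraType positivity_sets => (x : 'rV[R]_3)).
  apply: measurable_fun_rV => i.
  apply: (measurability _ (RGenOInfty.measurableE R)).
  move=> _ [_ [a ->] <-]; rewrite setTI.
  rewrite (_ : _ @^-1` _ = \bigcup_n (cube n.+1%:R `&`
      [set x : 'rV[R]_3 | a < x 0 i])); last first.
    apply/seteqP; split=> [x /=|x [n _ [_ /=]]]; rewrite in_itv/= andbT// => ax.
    by have [n xn] := cube_cover x; exists n.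
  apply: bigcup_measurable => n _; apply: sub_sigma_algebra.
  have [phi [[Cphi [K cK phiK]] phi0 ->]] := positivity_sets_cube n.
  pose f := flat 0 \o ((fun x : 'rV[R]_3 => x 0 i) + cst (- a)).
  exists (f * phi); split.
  - split=> [k|].
      apply: CkM => //; apply: Ck_flat; apply: CkD; first exact: Ck_coord.
      exact: Ck_cst.
    exists K => // x /phiK px0; rewrite [LHS](_ : _ = f x * phi x)//.
    by rewrite px0 mulr0.
  - by move=> x; apply: mulr_ge0 => //; exact: flat_ge0.
  - apply/seteqP; split=> x /=; rewrite [(f * phi) x](_ : _ = f x * phi x)//.
      by move=> [px ax]; apply: mulr_gt0 => //; rewrite flat0_gt0 subr_gt0.
    rewrite lt0r mulf_eq0 negb_or => /andP[/andP[fx px] _].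
    split; first by rewrite lt0r px phi0.
    by move: fx; rewrite -subr_gt0 -flat0_gt0 lt0r flat_ge0 andbT.
move=> A mA; have := measurable_preimage mid mA.
by rewrite preimage_id.
Qed.

Lemma compact_sub_cube (K : set 'rV[R]_3) : compact K -> exists n, K `<=` cube n.+1%:R.
Proof.
move=> /compact_bounded[M [_ /(_ (M + 1))]]; rewrite ltrDl ltr01 => /(_ isT) KM.
exists (Num.trunc (M + 1)) => x Kx; apply/cubeP => i.
apply: le_lt_trans (truncnS_gt _); apply: le_trans (KM x Kx).
rewrite [leRHS]mx_normrE.
exact: (le_bigmax _ (fun j => `|x j.1 j.2|) (0, i)).
Qed.

Lemma test_function_sub_cube phi : test_function phi ->
  exists n, forall x, ~ cube n.+1%:R x -> phi x = 0.
Proof.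
move=> [_ [K cK phiK]]; have [n Kn] := compact_sub_cube cK.
by exists n => x nx; apply: phiK => /Kn.
Qed.

Lemma integral_test_cube n g phi : (forall x, ~ cube n.+1%:R x -> phi x = 0) ->
  (\int[lebesgue3]_x (g x * phi x)%:E = \int[lebesgue3]_(x in cube n.+1%:R) (g x * phi x)%:E)%E.
Proof.
move=> phi0; rewrite [RHS]integral_mkcond; apply: eq_integral => x _.
rewrite patchE; case: ifPn => // /negP nx; rewrite phi0 ?mulr0// => xn.
by apply: nx; rewrite inE.
Qed.

Lemma test_function_bounded phi : test_function phi ->
  exists M, forall x, `|phi x| <= M.
Proof.
move=> tphi; have cphi := test_function_continuous tphi.
have [_ [K cK phiK]] := tphi.
have /compact_bounded[M [_ /(_ (M + 1))]] : compact (phi @` K).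
  by apply: continuous_compact => //; exact: continuous_subspaceT.
rewrite ltrDl ltr01 => /(_ isT) KM; exists (Num.max 0 (M + 1)) => x.
have [Kx|/phiK ->] := pselect (K x); last by rewrite normr0 le_max lexx.
by rewrite le_max (KM (phi x)) ?orbT//; exists x.
Qed.

Lemma integrable_mul_test_function g phi : integrable_on_cubes g -> measurable_fun setT g ->
  test_function phi ->
  (@lebesgue3 R).-integrable setT (fun x => (g x * phi x)%:E).
Proof.
move=> gi mg tphi; have [M phiM] := test_function_bounded tphi.
have [n phi0] := test_function_sub_cube tphi.
have mC := measurable_cube (n.+1%:R : R).
have mphi : measurable_fun setT phi.
  by apply: continuous_measurable_rV; exact: test_function_continuous.
have mgphi : measurable_fun setT (fun x => (g x * phi x)%:E).
  by apply/measurable_EFinP; exact: measurable_funM.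
have : (@lebesgue3 R).-integrable (cube n.+1%:R) (fun x => (g x * phi x)%:E).
  apply: (le_integrable mC _ _ (integrableZr mC M (gi n))).
    exact: measurable_funTS.
  move=> x _ /=; rewrite lee_fin !normrM ler_wpM2l//.
  by rewrite (le_trans (phiM x))// ler_norm.
move=> /(integrable_mkcond _ mC).
apply: eq_integrable => // x _.
rewrite patchE; case: ifPn => // /negP nx; rewrite phi0 ?mulr0// => xn.
by apply: nx; rewrite inE.
Qed.

Lemma cvg_integral_mollify g phi : integrable_on_cubes g -> measurable_fun setT g ->
  test_function phi -> (forall x, 0 <= phi x) ->
  (\int[lebesgue3]_x (g x * mollify phi n x)%:E @[n --> \oo] -->
   \int[lebesgue3]_(x in [set x | (0 < phi x)%R]) (g x)%:E)%E.
Proof.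
move=> gi mg tphi phi0; have [n phin] := test_function_sub_cube tphi.
have mC := measurable_cube (n.+1%:R : R).
set U := [set x : 'rV[R]_3 | (0 < phi x)%R].
have UC : U `<=` cube n.+1%:R.
  by move=> x; rewrite /U /= => px; apply: contrapT => /phin p0; rewrite p0 ltxx in px.
have mphi f : test_function f -> measurable_fun setT f.
  by move=> tf; apply: continuous_measurable_rV; exact: test_function_continuous.
have mU : measurable U.
  rewrite (_ : U = phi @^-1` `]0, +oo[%classic).
    by apply: measurable_preimage => //; exact: mphi.
  by apply/seteqP; split=> x /=; rewrite in_itv/= andbT.
have -> : (\int[lebesgue3]_(x in U) (g x)%:E =
    \int[lebesgue3]_(x in cube n.+1%:R) (g x * \1_U x)%:E)%E.
  rewrite integral_mkcond [RHS]integral_mkcond; apply: eq_integral => x _.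
  rewrite !patchE indicE; case: ifPn => xU; last first.
    by rewrite mulr0; case: ifP.
  by rewrite mulr1 ifT// inE; apply: UC; exact: set_mem.
under eq_fun => k.
  rewrite (@integral_test_cube n); last first.
    by move=> x /phin p0; rewrite mollify0// p0.
  over.
have [] := @dominated_convergence _ _ _ lebesgue3 _ mC
  (fun k x => (g x * mollify phi k x)%:E) (fun x => (g x * \1_U x)%:E)
  (fun x => `|g x|%:E).
- move=> k; apply: measurable_funTS; apply/measurable_EFinP; apply: measurable_funM => //.
  by apply: mphi; exact: test_function_mollify.
- apply: measurable_funTS; apply/measurable_EFinP; apply: measurable_funM => //.
- apply/aeW => x _; apply: cvg_EFin; first by near=> k.
  by apply: cvgMr; exact: cvg_mollify.
- exact: integrable_abse (gi n).
- apply/aeW => x k _; rewrite lee_fin normrM ler_piMr//.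
  by rewrite ger0_norm ?mollify_ge0// mollify_le1.
by [].
Unshelve. all: by end_near. Qed.

(** The integrals of [g] and [h] agree on every set [{phi > 0}], by dominated
    convergence along [mollify phi n]; such sets form a generating pi-system. *)
Lemma du_bois_reymond g h :
    integrable_on_cubes g -> integrable_on_cubes h ->
    measurable_fun setT g -> measurable_fun setT h ->
    (forall phi, test_function phi ->
      \int[lebesgue3]_x (g x * phi x) = \int[lebesgue3]_x (h x * phi x)) ->
  {ae lebesgue3, forall x, g x = h x}.
Proof.
move=> gi hi mg mh gh.
have key n : ae_eq lebesgue3 (cube n.+1%:R) (EFin \o g) (EFin \o h).
  apply: (ae_eq_pi_system measurable_positivity_sets positivity_setsI
    (positivity_sets_cube n)) => // _ [phi [tphi phi0 ->]] _.
  have := cvg_integral_mollify gi mg tphi phi0.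
  have := cvg_integral_mollify hi mh tphi phi0.
  rewrite (_ : (fun k => _) = (fun k => (\int[lebesgue3]_x (g x * mollify phi k x)%:E)%E)).
    by move=> ch cg; rewrite -(cvg_lim _ ch)// -(cvg_lim _ cg).
  apply/funext => k; have tm := test_function_mollify k tphi.
  rewrite -[LHS]fineK; last exact: integrable_fin_num (integrable_mul_test_function hi mh tm).
  rewrite -[RHS]fineK; last exact: integrable_fin_num (integrable_mul_test_function gi mg tm).
  by congr EFin; apply/esym; exact: gh.
have := ae_foralln key; apply: filterS => x gx.
have [n xn] := cube_cover x.
by have [] := gx n xn.
Qed.

End du_bois_reymond.

(** * Rotation invariance of the form *)

Lemma Rintegral_lincomb d (T : measurableType d) (R : realType)
    (mu : {measure set T -> \bar R}) (I : Type) (s : seq I) (c : I -> R) (f : I -> T -> R) :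
  (forall i, mu.-integrable setT (EFin \o f i)) ->
  \int[mu]_x (\sum_(i <- s) c i * f i x) = \sum_(i <- s) c i * \int[mu]_x f i x.
Proof.
move=> fi.
suff [] : mu.-integrable setT (EFin \o (fun x => \sum_(i <- s) c i * f i x)) /\
  \int[mu]_x (\sum_(i <- s) c i * f i x) = \sum_(i <- s) c i * \int[mu]_x f i x by [].
elim: s => [|i s [IHi IH]].
  have -> : (fun x : T => \sum_(i <- [::]) c i * f i x) = cst 0.
    by apply/funext => x; rewrite big_nil.
  split; first exact: integrable0.
  by rewrite big_nil Rintegral_cst// mul0r.
have cfi : mu.-integrable setT (EFin \o (fun x => c i * f i x)).
  rewrite (_ : _ \o _ = (fun x => (c i)%:E * (EFin \o f i) x)%E)//.
  exact: integrableZl.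
split.
  have -> : EFin \o (fun x : T => \sum_(i <- i :: s) c i * f i x) =
      ((EFin \o (fun x => (c i * f i x)%R)) \+ (EFin \o (fun x => (\sum_(i <- s) c i * f i x)%R)))%E.
    by apply/funext => x; rewrite /= big_cons EFinD.
  exact: integrableD.
rewrite big_cons -IH -RintegralZl// -RintegralD//.
by apply: eq_Rintegral => x _; rewrite big_cons.
Qed.

Lemma ae_lebesgue3_refm (R : realType) (gamma : R) (P : 'rV[R]_3 -> Prop) :
  {ae lebesgue3, forall x, P x} -> {ae refm gamma, forall x, P x}.
Proof.
move=> [N [mN N0 PN]]; exists N; split=> //.
apply: null_set_integral => //; apply: measurable_funTS.
by apply/measurable_EFinP; apply: measurable_funX; exact: measurable_psi.
Qed.

Section gradient.
Context (R : realType) (gamma : R) (gamma_gt0 : 0 < gamma).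
Implicit Types (u v phi : 'rV[R]_3 -> R) (g h : 'rV[R]_3 -> 'rV[R]_3).

Lemma derive_row phi (w x : 'rV[R]_3) : differentiable phi x ->
  'D_w phi x = \sum_j w 0 j * 'D_(delta_mx 0 j) phi x.
Proof.
move=> dphi; rewrite deriveE// {1}(row_sum_delta w) linear_sum.
by apply: eq_bigr => j _; rewrite linearZ deriveE.
Qed.

Lemma L2_gradient_measurable u g : L2_gradient gamma u g -> measurable_fun setT g.
Proof. by move=> [_ L2g]; apply: measurable_fun_rV => i; exact: L2_measurable. Qed.

(** The coordinates of [g] and [h] have the same integrals against every test
    function [phi], namely minus the integral of [u * 'D_i phi]. *)
Lemma L2_gradient_unique u g h : L2_gradient gamma u g -> L2_gradient gamma u h ->
  {ae lebesgue3, forall x, g x = h x}.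
Proof.
move=> [ug L2g] [uh L2h].
have gh i : {ae lebesgue3, forall x, g x 0 i = h x 0 i}.
  apply: du_bois_reymond.
  - exact: (L2_integrable_on_cubes gamma_gt0).
  - exact: (L2_integrable_on_cubes gamma_gt0).
  - exact: L2_measurable.
  - exact: L2_measurable.
  - by move=> phi tphi; apply: oppr_inj; rewrite -ug// -uh.
(* Countable unions of null sets are indexed by [nat]: an index [n >= 3] is not
   the value of any coordinate, and the corresponding condition is empty. *)
have : {ae lebesgue3, forall x, forall n : nat, forall i : 'I_3, n = i -> g x 0 i = h x 0 i}.
  apply: ae_foralln => n; have [n3|n3] := ltnP n 3.
    apply: filterS (gh (Ordinal n3)) => x gx i ni.
    by rewrite (_ : i = Ordinal n3)//; exact: val_inj.
  by apply: aeW => x i ni; have := ltn_ord i; rewrite -ni ltnNge n3.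
by apply: filterS => x gx; apply/rowP => i; exact: (gx i).
Qed.

Section rotation.
Variables (Q : 'M[R]_3) (QQT : Q *m Q^T = 1%:M).

Lemma L2_rotation u : L2 gamma u -> L2 gamma (fun x => u (x *m Q)).
Proof.
rewrite /L2 /= !inE => /andP[/[!inE]/= mu nu]; apply/andP; split; rewrite inE/=.
  exact: (measurableT_comp mu (measurable_mulmxr Q)).
move: nu; rewrite /finite_norm unlock /Lnorm.
rewrite -(integral_rotation QQT _ (preserves_refm QQT gamma)).
exact.
Qed.

Lemma L2_lincomb (I : Type) (s : seq I) (c : I -> R) (f : I -> 'rV[R]_3 -> R) :
  (forall i, L2 gamma (f i)) -> L2 gamma (fun x => \sum_(i <- s) c i * f i x).
Proof.
move=> L2f; rewrite /L2 /= (_ : (fun x => _) = \sum_(i <- s) c i *: f i); last first.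
  by apply/funext => x; rewrite fct_sumE.
have p1 : (1 <= 2%:E :> \bar R)%E by rewrite lee_fin ler1n.
have [L20 L2D] := Lfun_submod_closed (refm gamma) p1.
elim: s => [|i s IH]; first by rewrite big_nil.
by rewrite big_cons; apply: L2D => //; exact: L2f.
Qed.

(** For a test function [phi], put [chi = phi o T^-1]. The chain rule gives
    [d_i phi (x) = sum_j Q_ij (d_j chi)(xQ)], and the change of variables [T] turns the
    integration by parts formula for [u o T] and [phi] into a combination of those
    for [u] and [chi]. *)
Lemma L2_gradient_rotation u g : L2 gamma u -> L2_gradient gamma u g ->
  L2_gradient gamma (fun x => u (x *m Q)) (fun x => g (x *m Q) *m Q^T).
Proof.
move=> L2u ugg; have [ug L2g] := ugg.
have gQ y i : (g y *m Q^T) 0 i = \sum_j Q i j * g y 0 j.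
  by rewrite mxE; apply: eq_bigr => j _; rewrite !mxE mulrC.
have L2i := L2_integrable_on_cubes gamma_gt0.
split=> [i phi tphi|i]; last first.
  have -> : (fun x => (g (x *m Q) *m Q^T) 0 i) = (fun x => \sum_j Q i j * g (x *m Q) 0 j).
    by apply/funext => x; rewrite gQ.
  by apply: L2_lincomb => j; exact: (L2_rotation (L2g j)).
have QTQ : Q^T *m Q^T^T = 1%:M by rewrite trmxK; exact: mulmx1C.
pose chi y := phi (y *m Q^T).
have tchi : test_function chi by exact: test_function_rotation.
have chiQ x : chi (x *m Q) = phi x by rewrite /chi -mulmxA QQT mulmx1.
have -> : \int[lebesgue3]_x (u (x *m Q) * 'D_(delta_mx 0 i) phi x) =
    \int[lebesgue3]_x (\sum_j Q i j * (u x * 'D_(delta_mx 0 j) chi x)).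
  rewrite -[RHS](Rintegral_rotation QQT _ (preserves_orthogonal QQT)).
  apply: eq_Rintegral => x _.
  have -> : 'D_(delta_mx 0 i) phi x = 'D_(delta_mx 0 i *m Q) chi (x *m Q).
    rewrite -[RHS](congr1 (@^~ x) (derive_mulmxr Q chi _)).
    by rewrite (_ : (fun y => chi (y *m Q)) = phi)//; apply/funext.
  rewrite derive_row; last by have [/(_ 1%N)[]] := tchi.
  rewrite mulr_sumr; apply: eq_bigr => j _.
  by rewrite mulrCA -rowE mxE.
rewrite Rintegral_lincomb; last first.
  move=> j; apply: (integrable_mul_test_function (L2i _ L2u) (L2_measurable L2u)).
  exact: test_function_derive.
have -> : \int[lebesgue3]_x ((g (x *m Q) *m Q^T) 0 i * phi x) =
    \int[lebesgue3]_x (\sum_j Q i j * (g x 0 j * chi x)).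
  rewrite -[RHS](Rintegral_rotation QQT _ (preserves_orthogonal QQT)).
  apply: eq_Rintegral => x _; rewrite gQ chiQ mulr_suml.
  by apply: eq_bigr => j _; rewrite mulrA.
rewrite Rintegral_lincomb; last first.
  by move=> j; apply: (integrable_mul_test_function (L2i _ (L2g j)) (L2_measurable (L2g j))).
rewrite -sumrN; apply: eq_bigr => j _.
by rewrite ug// mulrN.
Qed.

Lemma form_domain_rotation u : form_domain gamma u ->
  form_domain gamma (fun x => u (x *m Q)).
Proof.
move=> [L2u [g ug]]; split; first exact: L2_rotation.
by exists (fun x => g (x *m Q) *m Q^T); exact: L2_gradient_rotation.
Qed.

Lemma gradP u : form_domain gamma u -> L2_gradient gamma u (grad gamma u).
Proof. by move=> [_ [g ug]]; exact: (xgetPex _ (ex_intro _ g ug)). Qed.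

Lemma grad_rotation u : form_domain gamma u ->
  {ae refm gamma, forall x, grad gamma (fun x => u (x *m Q)) x =
                            grad gamma u (x *m Q) *m Q^T}.
Proof.
move=> Fu; apply: ae_lebesgue3_refm.
apply: L2_gradient_unique; first exact: (gradP (form_domain_rotation Fu)).
by apply: L2_gradient_rotation; [case: Fu|exact: gradP].
Qed.

(** The selected gradient of [u o T] is a.e. the rotated one by uniqueness, and
    [Q^T] preserves the scalar product. *)
Lemma form_rotation u v : form_domain gamma u -> form_domain gamma v ->
  Defs.form gamma (fun x => u (x *m Q)) (fun x => v (x *m Q)) = Defs.form gamma u v.
Proof.
move=> Fu Fv.
suff E : \int[refm gamma]_x dot (grad gamma (fun x => u (x *m Q)) x)
                                (grad gamma (fun x => v (x *m Q)) x) =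
         \int[refm gamma]_x dot (grad gamma u x) (grad gamma v x).
  by rewrite /Defs.form E.
rewrite -[RHS](Rintegral_rotation QQT _ (preserves_refm QQT gamma)).
have mg w : form_domain gamma w -> measurable_fun setT (grad gamma w).
  by move=> Fw; exact: (L2_gradient_measurable (gradP Fw)).
congr fine; apply: ae_eq_integral => //.
- apply/measurable_EFinP; apply: measurable_dot; apply: mg; exact: form_domain_rotation.
- apply/measurable_EFinP; apply: (measurable_dot (f := grad gamma u \o mulmxr Q) (g := grad gamma v \o mulmxr Q)).
    exact: (measurableT_comp (mg _ Fu) (measurable_mulmxr Q)).
  exact: (measurableT_comp (mg _ Fv) (measurable_mulmxr Q)).
have QTQ : Q^T *m Q^T^T = 1%:M by rewrite trmxK; exact: mulmx1C.
move: (grad_rotation Fu) (grad_rotation Fv); apply: filterS2 => x -> -> _.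
by rewrite dot_mulmxr.
Qed.

End rotation.
End gradient.

(** * The rotated process *)

Section rotated_process.
Context (R : realType) d (Omega : measurableType d).
Variables (X : R -> Omega -> 'rV[R]_3) (P : 'rV[R]_3 -> probability Omega R).
Variables (Q : 'M[R]_3) (QQT : Q *m Q^T = 1%:M).

Let QTQ : Q^T *m Q = 1%:M. Proof. exact: mulmx1C. Qed.

Let QTQTT : Q^T *m Q^T^T = 1%:M. Proof. by rewrite trmxK. Qed.

Lemma invmx_orthogonal : invmx Q = Q^T.
Proof.
have [Qu _] := mulmx1_unit QQT.
by rewrite -[RHS]mul1mx -(mulVmx Qu) -mulmxA QQT mulmx1.
Qed.

Let invQK (x : 'rV[R]_3) : x *m invmx Q *m Q = x.
Proof. by rewrite invmx_orthogonal -mulmxA QTQ mulmx1. Qed.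

Let QKinv (x : 'rV[R]_3) : x *m Q *m invmx Q = x.
Proof. by rewrite invmx_orthogonal -mulmxA QQT mulmx1. Qed.

Lemma natural_filtration_rotation :
  natural_filtration (image_process Q X) = natural_filtration X.
Proof.
apply/funext => t; congr (<<s _ >>); apply/seteqP; split=> _ [s [B [st mB ->]]].
  exists s, ((fun x => x *m Q) @^-1` B); split=> //.
  by apply: measurable_preimage => //; exact: measurable_mulmxr.
exists s, ((fun x => x *m invmx Q) @^-1` B); split=> //.
  by apply: measurable_preimage => //; exact: measurable_mulmxr.
by apply/seteqP; split=> w /=; rewrite /image_process QKinv.
Qed.

(** [T(X)] has the same stopping times and prior events as [X]; the strong Markov
    property of [X] for the target set [T^-1 B] is the one of [T(X)] for [B], since
    the law of [T(X)] started at [X_tau Q] is that of [X] started at [X_tau]. *)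
Lemma strong_markov_rotation : strong_markov X P ->
  strong_markov (image_process Q X) (image_law Q P).
Proof.
have rE : right_filtration (image_process Q X) = right_filtration X.
  by apply/funext => t; rewrite /right_filtration natural_filtration_rotation.
move=> mX tau; rewrite /stopping_time rE => tauX A.
rewrite /stopped_filtration rE => tauA x s B s0 mB.
have mQB : measurable ((fun x : 'rV[R]_3 => x *m Q) @^-1` B).
  by apply: measurable_preimage => //; exact: measurable_mulmxr.
rewrite [LHS](mX tau tauX A tauA (x *m invmx Q) s _ s0 mQB).
by apply: eq_integral => w _; rewrite /image_law /image_process QKinv.
Qed.

Lemma diffusion_rotation : diffusion X P ->
  diffusion (image_process Q X) (image_law Q P).
Proof.
move=> [mX kX sX cX smX]; split.
- by move=> t t0; exact: (measurableT_comp (measurable_mulmxr Q) (mX t t0)).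
- move=> t B t0 mB.
  have mQB : measurable ((fun x : 'rV[R]_3 => x *m Q) @^-1` B).
    by apply: measurable_preimage => //; exact: measurable_mulmxr.
  exact: (measurableT_comp (kX t _ t0 mQB) (measurable_mulmxr (invmx Q))).
- move=> x; rewrite -[RHS](sX (x *m invmx Q)) /image_law /image_process.
  congr (P _ _); apply/seteqP; split=> w /= => [<-|->]; first by rewrite QKinv.
  by rewrite invQK.
- move=> w t.
  exact: (continuous_comp (cX w t) (@continuous_mulmxr R 3 Q (X t w))).
- exact: strong_markov_rotation.
Qed.

Lemma symmetric_process_rotation (m : {measure set 'rV[R]_3 -> \bar R}) :
  preserves m (fun x => x *m Q) ->
  symmetric_process X P m ->
  symmetric_process (image_process Q X) (image_law Q P) m.
Proof.
move=> mQ sX t f g t0 mf mg f0 g0.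
have mT := measurable_mulmxr Q.
have := sX t (fun x => f (x *m Q)) (fun x => g (x *m Q)) t0
  (measurableT_comp mf mT) (measurableT_comp mg mT) (fun x => f0 _) (fun x => g0 _).
rewrite -[in X in _ -> X = _](integral_rotation QQT _ mQ).
rewrite -[in X in _ -> _ = X](integral_rotation QQT _ mQ) => fg.
transitivity (\int[m]_x ((\int[P x]_w f (X t w *m Q)) * g (x *m Q)))%E.
  by apply: eq_integral => x _; rewrite /image_law QKinv.
rewrite fg; apply: eq_integral => x _.
by rewrite /image_law QKinv.
Qed.

Lemma approx_form_rotation (m : {measure set 'rV[R]_3 -> \bar R}) t u v :
  preserves m (fun x => x *m Q) ->
  approx_form (image_process Q X) (image_law Q P) m t u v =
  approx_form X P m t (fun x => u (x *m Q)) (fun x => v (x *m Q)).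
Proof.
move=> mQ.
suff E : \int[m]_x ((u x - semigroup (image_process Q X) (image_law Q P) t u x) * v x) =
    \int[m]_x ((u (x *m Q) - semigroup X P t (fun x => u (x *m Q)) x) * v (x *m Q)).
  by rewrite /approx_form E.
rewrite -[LHS](Rintegral_rotation QQT _ mQ).
by apply: eq_Rintegral => x _; rewrite /semigroup /image_law QKinv.
Qed.

(** The approximating forms of [T(X)] at [(u, v)] are those of [X] at
    [(u o T, v o T)], whose limit is [E(u o T, v o T) = E(u, v)]. For the domain, [u] is
    recovered from [u o T] by the inverse rotation. *)
Lemma dirichlet_form_rotation (gamma : R) : 0 < gamma ->
  dirichlet_form_of X P (refm gamma) (Defs.form gamma) (form_domain gamma) ->
  dirichlet_form_of (image_process Q X) (image_law Q P)
    (refm gamma) (Defs.form gamma) (form_domain gamma).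
Proof.
move=> gamma0 [FE Elim].
have mQ := preserves_refm QQT gamma.
have approxE u v : (fun t => approx_form (image_process Q X) (image_law Q P) (refm gamma) t u v) =
    (fun t => approx_form X P (refm gamma) t (fun x => u (x *m Q)) (fun x => v (x *m Q))).
  by apply/funext => t; exact: approx_form_rotation.
have QTK (u : 'rV[R]_3 -> R) : (fun x => u (x *m Q^T *m Q)) = u.
  by apply/funext => x; rewrite -mulmxA QTQ mulmx1.
split; last first.
  move=> u v Fu Fv; rewrite approxE -(form_rotation gamma0 QQT Fu Fv).
  by apply: Elim; exact: form_domain_rotation.
apply/seteqP; split=> u.
  move=> Fu; have FuQ := form_domain_rotation gamma0 QQT Fu.
  split; first by case: Fu.
  by rewrite approxE; move: FuQ; rewrite FE => -[].
move=> [L2u cu]; rewrite -(QTK u); apply: (form_domain_rotation gamma0 QTQTT (u := fun x => u (x *m Q))).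
by rewrite FE; split; [exact: L2_rotation|rewrite -approxE].
Qed.

End rotated_process.

Theorem mainTheorem11 (R : realType) (gamma : R) (gamma_gt0 : 0 < gamma)
    (d : measure_display) (Omega : measurableType d)
    (X : R -> Omega -> 'rV[R]_3) (P : 'rV[R]_3 -> probability Omega R)
    (X_assoc : associated_diffusion X P gamma)
    (Q : 'M[R]_3) (Q_orthogonal : Q *m Q^T = 1%:M) :
  associated_diffusion (image_process Q X) (image_law Q P) gamma.
Proof.
have [dX sX fX] := X_assoc; split.
- exact: diffusion_rotation.
- by apply: symmetric_process_rotation => //; exact: preserves_refm.
- exact: dirichlet_form_rotation.
Qed.
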